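(* Let $\mathcal{X}_1,\mathcal{X}_2,\mathcal{Y}$ be finite alphabets, let $(X_1,X_2,Y)$ have joint pmf $p(x_1,x_2,y)$ on $\mathcal{X}_1\times\mathcal{X}_2\times\mathcal{Y}$ such that $X_1-Y-X_2$ is a Markov chain, and let $K\geq1$ be an integer. Let $\mathcal{R}_{\text{CDIB}}^{\text{outer}}(K)$ be the set of tuples $(R_1,R_2,\mu)\in\mathbb{R}^3_{\geq0}$ for which there exist auxiliary random variables $\{V_{1,l},V_{2,l}\}_{l=1}^K$, jointly distributed with $(X_1,X_2,Y)$, simultaneously satisfying \begin{align*} R_1&\geq I(X_1;W_{1,K+1}|X_2),\\ R_2&\geq \left[I(X_2;W_{1,K+1}|Y)-I(Y;W_{2,K})+\mu\right]^{+},\\ R_1+R_2&\geq I(X_1X_2;W_{1,K+1}|Y)+\mu,\\ \mu&\leq I(Y;W_{1,K+1}), \end{align*} the Markov chains $$V_{1,l} - (X_1,W_{1,l}) - (X_2,Y),\qquad V_{2,l} - (X_2,W_{2,l}) - (X_1,Y),\qquad l\in[1:K],$$ and taking values in finite alphabets $\mathcal{V}_{1,l},\mathcal{V}_{2,l}$ with cardinalities bounded by \begin{align*} |\mathcal{V}_{1,l}|&\leq|\mathcal{X}_1||\mathcal{W}_{1,l}|+4,\quad l\in[1:K],\\ |\mathcal{V}_{2,l}|&\leq|\mathcal{X}_2||\mathcal{W}_{2,l}|+4,\quad l\in[1:K-1],\\ |\mathcal{V}_{2,K}|&\leq|\mathcal{X}_2||\mathcal{W}_{2,K}|+1, \end{align*}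 where $|\mathcal{W}_{1,l}|=\prod_{i=1}^{l-1}|\mathcal{V}_{1,i}||\mathcal{V}_{2,i}|$ and $|\mathcal{W}_{2,l}|=|\mathcal{W}_{1,l}||\mathcal{V}_{1,l}|$ for $l\in[1:K]$. Then $\mathcal{R}_{\text{CDIB}}^{\text{outer}}(K)\supseteq\mathcal{R}_{\text{CDIB}}(K)$.
   Context: All logarithms are base 2; $[a]^+=\max\{a,0\}$. $A-B-C$ denotes a Markov chain, i.e. $p(a|b,c)=p(a|b)$. Given random variables $V_{1,l},V_{2,l}$, set $W_{1,l}=\{V_{1,k},V_{2,k}\}_{k=1}^{l-1}$ for $l\in[1:K+1]$ (so $W_{1,1}$ is empty/constant) and $W_{2,l}=\{W_{1,l},V_{1,l}\}$ for $l\in[1:K]$. Let $(X_1^n,X_2^n,Y^n)$ be $n$ i.i.d. copies of $(X_1,X_2,Y)$. A $K$-step $n$-length CDIB code consists of, for $l\in[1:K]$, finite message sets $\mathcal{I}_l=\{1,\dots,|\mathcal{I}_l|\}$, $\mathcal{J}_l=\{1,\dots,|\mathcal{J}_l|\}$ and encoder mappings $$f_l:\mathcal{X}_1^n\times\mathcal{J}_1\times\cdots\times\mathcal{J}_{l-1}\to\mathcal{I}_l,\qquad g_l:\mathcal{X}_2^n\times\mathcal{I}_1\times\cdots\times\mathcal{I}_l\to\mathcal{J}_l .$$ The messages are $I_l=f_l(X_1^n,J_1,\dots,J_{l-1})$ and $J_l=g_l(X_2^n,I_1,\dots,I_l)$, with $I^K=(I_1,\dots,I_K)$, $J^K=(J_1,\dots,J_K)$.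 A triple $(R_1,R_2,\mu)\in\mathbb{R}^3_{\geq0}$ is $K$-achievable if for every $\varepsilon>0$ there is $n_0(\varepsilon)$ such that for all $n>n_0(\varepsilon)$ there is a $K$-step $n$-length CDIB code with $$\tfrac1n\sum_{l=1}^K\log|\mathcal{I}_l|\leq R_1+\varepsilon,\quad \tfrac1n\sum_{l=1}^K\log|\mathcal{J}_l|\leq R_2+\varepsilon,\quad \mu-\varepsilon\leq\tfrac1n I(Y^n;I^KJ^K).$$ $\mathcal{R}_{\text{CDIB}}(K)$ is the set of all $K$-achievable triples. *)

(* Defs.v *)
From HB Require Import structures.
From mathcomp Require Import all_boot all_order all_algebra.
From mathcomp Require Import classical_sets reals exp.

Set Implicit Arguments.
Unset Strict Implicit.
Unset Printing Implicit Defensive.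

Import Order.TTheory GRing.Theory Num.Theory.
Local Open Scope classical_set_scope.
Local Open Scope ring_scope.

Definition log2 (R : realType) (x : R) : R := ln x / ln 2.

(* A finite probability space is a finType T with a pmf P; a random variable
   with finite alphabet A is a function T -> A. *)
Definition is_pmf (R : realType) (T : finType) (P : T -> R) : Prop :=
  (forall t, 0 <= P t) /\ \sum_t P t = 1.

Notation "[% A , B ]" := (fun w => (A w, B w))
  (at level 0, A at level 99, B at level 99, format "[%  A ,  B ]").

(* P(A = a) *)
Definition law (R : realType) (T A_ : finType) (P : T -> R) (A : T -> A_)
    (a : A_) : R :=
  \sum_(t | A t == a) P t.

(* P(A = a | B = b); only meaningful when P(B = b) != 0. *)
Definition claw (R : realType) (T A_ B_ : finType) (P : T -> R)
    (A : T -> A_) (B : T -> B_) (a : A_) (b : B_) : R :=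
  law P [% A, B] (a, b) / law P B b.

(* A - B - C *)
Definition markov_chain (R : realType) (T A_ B_ C_ : finType) (P : T -> R)
    (A : T -> A_) (B : T -> B_) (C : T -> C_) : Prop :=
  forall a b c, law P [% B, C] (b, c) != 0 ->
    claw P A [% B, C] a (b, c) = claw P A B a b.

(* I(A; B). A summand with P(A = a, B = b) = 0 is 0; otherwise the argument
   of the logarithm is a quotient of positive numbers. *)
Definition mutual_info (R : realType) (T A_ B_ : finType) (P : T -> R)
    (A : T -> A_) (B : T -> B_) : R :=
  \sum_a \sum_b law P [% A, B] (a, b) *
    log2 (law P [% A, B] (a, b) / (law P A a * law P B b)).

(* I(A; B | C), with the same remark on null summands. *)
Definition cond_mutual_info (R : realType) (T A_ B_ C_ : finType) (P : T -> R)
    (A : T -> A_) (B : T -> B_) (C : T -> C_) : R :=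
  \sum_a \sum_b \sum_c law P [% [% A, B], C] ((a, b), c) *
    log2 (claw P [% A, B] C (a, b) c / (claw P A C a c * claw P B C b c)).

(* Steps are numbered from 0 and families are indexed by nat: in a K-step
   object only the indices l < K matter, the other entries are never used.
   hist A l is the cartesian product A 0 * ... * A (l - 1). *)
Fixpoint hist (A : nat -> finType) (l : nat) : finType :=
  if l is k.+1 then (hist A k * A k)%type else unit.

Fixpoint past (T : finType) (A : nat -> finType) (V : forall l, T -> A l)
    (l : nat) : T -> hist A l :=
  if l is k.+1 then [% past V k, V k] else fun=> tt.

Definition ord_alphabet (m : nat -> nat) (l : nat) : finType := 'I_(m l).

(* code_nI l, code_nJ l are the sizes of the message sets of step l. *)
Record cdib_code (X1 X2 : finType) (n : nat) := CdibCode {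
  code_nI : nat -> nat;
  code_nJ : nat -> nat;
  code_f : forall l, {ffun 'I_n -> X1} -> hist (ord_alphabet code_nJ) l ->
             ord_alphabet code_nI l;
  code_g : forall l, {ffun 'I_n -> X2} -> hist (ord_alphabet code_nI) l.+1 ->
             ord_alphabet code_nJ l }.

(* The messages ((I_0, ..., I_(l-1)), (J_0, ..., J_(l-1))). *)
Fixpoint messages (X1 X2 : finType) (n : nat) (c : cdib_code X1 X2 n)
    (x1 : {ffun 'I_n -> X1}) (x2 : {ffun 'I_n -> X2}) (l : nat) :
    hist (ord_alphabet (code_nI c)) l * hist (ord_alphabet (code_nJ c)) l :=
  if l is k.+1 then
    let: (i, j) := messages c x1 x2 k in
    let i' := (i, code_f x1 j) in
    (i', (j, code_g x2 (i' : hist (ord_alphabet (code_nI c)) k.+1)))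
  else (tt, tt).

(* The law of n i.i.d. copies of a source with pmf p. *)
Definition iid_pmf (R : realType) (S : finType) (p : S -> R) (n : nat)
    (s : {ffun 'I_n -> S}) : R :=
  \prod_(i < n) p (s i).

Definition srcX1 (X1 X2 Y : Type) (s : X1 * X2 * Y) : X1 := s.1.1.
Definition srcX2 (X1 X2 Y : Type) (s : X1 * X2 * Y) : X2 := s.1.2.
Definition srcY (X1 X2 Y : Type) (s : X1 * X2 * Y) : Y := s.2.

Definition blockwise (S A : finType) (h : S -> A) (n : nat)
    (s : {ffun 'I_n -> S}) : {ffun 'I_n -> A} := [ffun i => h (s i)].

Definition achievable (R : realType) (X1 X2 Y : finType)
    (p : X1 * X2 * Y -> R) (K : nat) (R1 R2 mu : R) : Prop :=
  [/\ 0 <= R1, 0 <= R2 & 0 <= mu] /\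
  forall eps : R, 0 < eps -> exists n0 : nat, forall n : nat, (n0 < n)%N ->
    exists c : cdib_code X1 X2 n,
    [/\ n%:R^-1 * (\sum_(l < K) log2 (code_nI c l)%:R) <= R1 + eps,
        n%:R^-1 * (\sum_(l < K) log2 (code_nJ c l)%:R) <= R2 + eps &
        mu - eps <= n%:R^-1 *
          mutual_info (iid_pmf p (n := n)) (blockwise (@srcY X1 X2 Y) (n := n))
            (fun s => messages c (blockwise (@srcX1 X1 X2 Y) s)
                                 (blockwise (@srcX2 X1 X2 Y) s) K)].

Definition cdib_region (R : realType) (X1 X2 Y : finType)
    (p : X1 * X2 * Y -> R) (K : nat) : set (R * R * R) :=
  [set t | achievable p K t.1.1 t.1.2 t.2].

(* W1rv l = (V1 k, V2 k)_(k < l) and W2rv l = (W1rv l, V1 l). *)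
Definition W1rv (T : finType) (A1 A2 : nat -> finType)
    (V1 : forall l, T -> A1 l) (V2 : forall l, T -> A2 l) (l : nat) :
    T -> hist (fun k => (A1 k * A2 k)%type : finType) l :=
  past (fun k => [% V1 k, V2 k]) l.

Definition W2rv (T : finType) (A1 A2 : nat -> finType)
    (V1 : forall l, T -> A1 l) (V2 : forall l, T -> A2 l) (l : nat) :
    T -> hist (fun k => (A1 k * A2 k)%type : finType) l * A1 l :=
  [% W1rv V1 V2 l, V1 l].

Definition cardW1 (A1 A2 : nat -> finType) (l : nat) : nat :=
  (\prod_(i < l) (#|A1 i| * #|A2 i|))%N.

Definition cardW2 (A1 A2 : nat -> finType) (l : nat) : nat :=
  (cardW1 A1 A2 l * #|A1 l|)%N.

(* The auxiliary variables live on a probability space (T, P) carrying a copy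
   (X1, X2, Y) of the source. With steps numbered from 0, the final variable
   of the second encoder is V2 K.-1, all pairs together are W1rv K, and all
   variables except V2 K.-1 are W2rv K.-1. *)
Definition in_outer_region (R : realType) (X1_ X2_ Y_ : finType)
    (p : X1_ * X2_ * Y_ -> R) (K : nat) (R1 R2 mu : R) : Prop :=
  [/\ 0 <= R1, 0 <= R2 & 0 <= mu] /\
  exists (T : finType) (P : T -> R)
    (X1 : T -> X1_) (X2 : T -> X2_) (Y : T -> Y_)
    (A1 A2 : nat -> finType)
    (V1 : forall l, T -> A1 l) (V2 : forall l, T -> A2 l),
    let W1 := W1rv V1 V2 in
    let W2 := W2rv V1 V2 in
    [/\ is_pmf P /\ (forall s, law P [% [% X1, X2], Y] s = p s),
        [/\ R1 >= cond_mutual_info P X1 (W1 K) X2,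
            R2 >= Num.max (cond_mutual_info P X2 (W1 K) Y
                           - mutual_info P Y (W2 K.-1) + mu) 0,
            R1 + R2 >= cond_mutual_info P [% X1, X2] (W1 K) Y + mu &
            mu <= mutual_info P Y (W1 K)],
        (forall l, (l < K)%N ->
           markov_chain P (V1 l) [% X1, W1 l] [% X2, Y] /\
           markov_chain P (V2 l) [% X2, W2 l] [% X1, Y]) &
        [/\ forall l, (l < K)%N -> (#|A1 l| <= #|X1_| * cardW1 A1 A2 l + 4)%N,
            forall l, (l < K.-1)%N ->
              (#|A2 l| <= #|X2_| * cardW2 A1 A2 l + 4)%N &
            (#|A2 K.-1| <= #|X2_| * cardW2 A1 A2 K.-1 + 1)%N]].

Definition outer_region (R : realType) (X1 X2 Y : finType)
    (p : X1 * X2 * Y -> R) (K : nat) : set (R * R * R) :=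
  [set t | in_outer_region p K t.1.1 t.1.2 t.2].

(* Main.v *)
(* The converse of a code single-letterizes with W at time q made of the whole
   transcript M, Y_i for i < q and X2_i for i > q, plus a time-sharing index. The
   rate bounds come from H(I), H(J), H(I, J) and the chain rule, run forwards for
   I(Y; M) and I(X1; M | X2) and backwards for I(X2; M | Y) and I(X1 X2; M | Y);
   the Markov chains hold because an interactive transcript preserves conditional
   independence, X1_i and X2_i (i < q) being independent given Y_i.

   The cardinality bounds follow by treating the auxiliary variables in order:
   multiplying P by a function r of the current variable V keeps all later
   Markov chains, and also the earlier ones if the law of (X, past) is kept; the
   remaining quantities are linear in r, so a basic solution of a linear
   programme has the required support. With alphabets now fixed, the tolerance
   of achievability goes to 0 by compactness of the simplex of laws and
   continuity of entropy. *)

Require Import Defs.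
From mathcomp Require Import all_boot all_order all_algebra.
From mathcomp Require Import boolp classical_sets interval_inference reals.
From mathcomp Require Import topology normedtype sequences exp.
From mathcomp Require Import ring lra zify.

Set Implicit Arguments.
Unset Strict Implicit.
Unset Printing Implicit Defensive.

Import Order.TTheory GRing.Theory Num.Theory.
Import numFieldNormedType.Exports.
Local Open Scope ring_scope.

(** * Entropy and mutual information *)

(** Every quantity is expressed by joint entropies of a masked source and a prefix of the
    transcript. A Markov chain is then a linear equation between entropies, the Shannon inequalities
    are monotonicity and submodularity in mask and prefix, and the rate bounds reduce to linear
    arithmetic. The form of W is forced by the bound on R2, where I(X2; W | Y) must be estimated
    from above and I(Y; W2) from below with the same W. Going forwards, the letter Y_q is
    conditioned on Y_i, i < q, and adding X2_i, i > q, to the condition can only raise its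
    information. Going backwards, X2_q is conditioned on all Y and on later letters, and forgetting
    Y_i, i > q, also goes in the right direction. The auxiliary variables of a code have alphabets
    that grow with the block length. The limit is therefore possible only after the reduction, and
    only once the reduced variables are copied to a space shared by all codes, [canon_space]. *)

Lemma ln2_gt0 (R : realType) : 0 < ln 2 :> R.
Proof. by apply: ln_gt0; rewrite ltr1n. Qed.

Lemma log2M (R : realType) (x y : R) :
  0 < x -> 0 < y -> log2 (x * y) = log2 x + log2 y.
Proof. by move=> x0 y0; rewrite /log2 lnM ?posrE// mulrDl. Qed.

Lemma log2_div (R : realType) (x y : R) :
  0 < x -> 0 < y -> log2 (x / y) = log2 x - log2 y.
Proof. by move=> x0 y0; rewrite /log2 ln_div ?posrE// mulrBl. Qed.

Lemma ln_le_sub1 (R : realType) (x : R) : 0 < x -> ln x <= x - 1.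
Proof. by move=> x0; rewrite -{1}[x](subrKC 1) le_ln1Dx// ltrBrDl subrr. Qed.

Lemma ln_eq_sub1 (R : realType) (x : R) : 0 < x -> ln x = x - 1 -> x = 1.
Proof.
move=> x0 lnx; apply/eqP/negPn/negP => x1.
have : x - 1 != 0 by rewrite subr_eq0.
by move/expR_gt1Dx; rewrite -lnx lnK ?posrE// lnx subrKC ltxx.
Qed.

Section Gibbs.
Variables (R : realType) (I : finType) (p q : I -> R).
Hypotheses (p_ge0 : forall i, 0 <= p i) (q_ge0 : forall i, 0 <= q i).
Hypothesis q_dom : forall i, q i = 0 -> p i = 0.

(** This is ln x <= x - 1 at x = q/p, whose equality case is x = 1; summing it gives both the Gibbs
    inequality and the case of equality. *)
Let gap i : 0 <= p i * ln (p i / q i) - (p i - q i) ?= iff (p i == q i).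
Proof.
have [pi0|pi0] := eqVneq (p i) 0.
  rewrite pi0 mul0r sub0r sub0r opprK; split; first exact: q_ge0.
  by rewrite eq_sym [RHS]eq_sym.
have pi : 0 < p i by rewrite lt_def pi0 p_ge0.
have qi : 0 < q i.
  by rewrite lt_def q_ge0 andbT; apply: contra pi0 => /eqP/q_dom/eqP.
have E : p i * ln (p i / q i) - (p i - q i) =
    p i * (q i / p i - 1 - ln (q i / p i)).
  by rewrite !ln_div ?posrE//; field; rewrite pi0.
have qp : 0 < q i / p i by rewrite divr_gt0.
rewrite E; split; first by rewrite mulr_ge0// subr_ge0 ln_le_sub1.
apply/eqP/eqP => [/esym/eqP|->]; last by rewrite divff ?gt_eqF// ln1; ring.
rewrite mulf_eq0 (negbTE pi0) subr_eq0 => /eqP/esym/(ln_eq_sub1 qp) qp1.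
by rewrite -[q i](divfK pi0) qp1 mul1r.
Qed.

Lemma gibbs_leif : \sum_i q i <= \sum_i p i ->
  (0 <= \sum_i p i * log2 (p i / q i)) /\
  (\sum_i p i * log2 (p i / q i) = 0 -> p =1 q).
Proof.
move=> le_qp.
have -> : \sum_i p i * log2 (p i / q i) = (\sum_i p i * ln (p i / q i)) / ln 2.
  by rewrite mulr_suml; apply: eq_bigr => i _; rewrite mulrA.
have E : \sum_i (p i * ln (p i / q i) - (p i - q i)) =
   \sum_i p i * ln (p i / q i) - (\sum_i p i - \sum_i q i).
  by rewrite !big_split/= !sumrN big_split/= sumrN.
have G : 0 <= \sum_i (p i * ln (p i / q i) - (p i - q i)).
  by apply: sumr_ge0 => i _; exact: gap.
split; first by rewrite divr_ge0 ?(ltW (ln2_gt0 R))//; lra.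
move=> /eqP; rewrite mulf_eq0 invr_eq0 [ln 2 == 0]gt_eqF ?ln2_gt0// orbF.
move=> /eqP S0 i.
have /eqP : \sum_i (p i * ln (p i / q i) - (p i - q i)) = 0 by lra.
rewrite psumr_eq0 => [/allP/(_ i)|j _]; last exact: gap.
by rewrite mem_index_enum eq_sym (gap i).2 => /(_ isT)/eqP.
Qed.

End Gibbs.

Section Law.
Variables (R : realType) (T : finType) (P : T -> R).

Lemma sum_law (A_ : finType) (A : T -> A_) (F : A_ -> R) :
  \sum_a law P A a * F a = \sum_t P t * F (A t).
Proof.
rewrite [RHS](partition_big A xpredT)//=; apply: eq_bigr => a _.
by rewrite /law mulr_suml; apply: eq_bigr => t /eqP ->.
Qed.

Lemma sum_law1 (A_ : finType) (A : T -> A_) : \sum_a law P A a = \sum_t P t.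
Proof.
have := sum_law A (fun=> 1).
by under eq_bigr do rewrite mulr1; under [in RHS]eq_bigr do rewrite mulr1.
Qed.

Lemma law_comp (A_ B_ : finType) (A : T -> A_) (f : A_ -> B_) b :
  law P (f \o A) b = \sum_(a | f a == b) law P A a.
Proof.
rewrite /law (partition_big A (fun a => f a == b))//=; apply: eq_bigr => a fa.
by apply: eq_bigl => t; case: (A t =P a) => [->|]; rewrite ?fa ?andbT ?andbF.
Qed.

Lemma law_law (A_ B_ : finType) (A : T -> A_) (f : A_ -> B_) b :
  law (law P A) f b = law P (f \o A) b.
Proof. by rewrite law_comp. Qed.

Lemma law_pairl (A_ B_ : finType) (A : T -> A_) (B : T -> B_) b :
  \sum_a law P [% A, B] (a, b) = law P B b.
Proof.
rewrite [RHS](law_comp [% A, B] snd).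
rewrite (reindex (fun a => (a, b))) /=; last first.
  by exists fst => [a _//|[a c] /=]; rewrite inE/= => /eqP ->.
by apply: eq_bigl => a; rewrite eqxx.
Qed.

Lemma eq_law (A_ : finType) (A B : T -> A_) : A =1 B -> law P A =1 law P B.
Proof. by move=> AB a; apply: eq_bigl => t; rewrite AB. Qed.

Definition ent (A_ : finType) (A : T -> A_) : R :=
  - \sum_a law P A a * log2 (law P A a).

Lemma ent_sumT (A_ : finType) (A : T -> A_) :
  ent A = - \sum_t P t * log2 (law P A (A t)).
Proof. by rewrite /ent (sum_law A (fun a => log2 (law P A a))). Qed.

(** Entropy sees a variable only through the partition that it induces on the support of P, so
    values can be renamed freely and null points ignored. *)
Lemma ent_eqv (A_ B_ : finType) (A : T -> A_) (B : T -> B_) :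
  (forall t t', P t != 0 -> P t' != 0 -> (A t == A t') = (B t == B t')) ->
  ent A = ent B.
Proof.
move=> AB; rewrite !ent_sumT; congr (- _); apply: eq_bigr => t _.
have [->|Pt] := eqVneq (P t) 0; first by rewrite !mul0r.
congr (_ * log2 _); rewrite /law big_mkcond [RHS]big_mkcond/=.
apply: eq_bigr => t' _; have [->|Pt'] := eqVneq (P t') 0.
  by rewrite !if_same.
by rewrite AB.
Qed.

Lemma ent_const (A_ : finType) (A : T -> A_) (a : A_) :
  \sum_t P t = 1 -> (forall t, A t = a) -> ent A = 0.
Proof.
move=> P1 Aa; rewrite ent_sumT big1 ?oppr0// => t _.
have -> : law P A (A t) = 1.
  by rewrite -[RHS]P1; apply: eq_bigl => t'; rewrite !Aa eqxx.
by rewrite /log2 ln1 mul0r mulr0.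
Qed.

Hypothesis P_ge0 : forall t, 0 <= P t.

Lemma law_ge0 (A_ : finType) (A : T -> A_) a : 0 <= law P A a.
Proof. exact: sumr_ge0. Qed.

Lemma law_gt0 (A_ : finType) (A : T -> A_) t : P t != 0 -> 0 < law P A (A t).
Proof.
move=> Pt; rewrite /law (bigD1 t)//= ltr_pwDl//; last exact: sumr_ge0.
by rewrite lt_def Pt P_ge0.
Qed.

Lemma law_comp_ge (A_ B_ : finType) (A : T -> A_) (f : A_ -> B_) a :
  law P A a <= law P (f \o A) (f a).
Proof.
rewrite law_comp (bigD1 a)//= lerDl; apply: sumr_ge0 => b _; exact: law_ge0.
Qed.

Lemma law_comp_eq0 (A_ B_ : finType) (A : T -> A_) (f : A_ -> B_) a :
  law P (f \o A) (f a) = 0 -> law P A a = 0.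
Proof.
move=> f0; apply/eqP; rewrite eq_le law_ge0 andbT -f0; exact: law_comp_ge.
Qed.

Definition mi (A_ B_ : finType) (A : T -> A_) (B : T -> B_) : R :=
  ent A + ent B - ent [% A, B].

Definition cmi (A_ B_ C_ : finType) (A : T -> A_) (B : T -> B_) (C : T -> C_) :=
  ent [% A, C] + ent [% B, C] - ent [% [% A, B], C] - ent C.

Lemma mutual_infoE (A_ B_ : finType) (A : T -> A_) (B : T -> B_) :
  mutual_info P A B = mi A B.
Proof.
rewrite /mutual_info pair_big/=.
transitivity (\sum_x law P [% A, B] x *
   log2 (law P [% A, B] x / (law P A x.1 * law P B x.2))).
  by apply: eq_bigr => -[].
rewrite (sum_law [% A, B] (fun x => log2 (law P [% A, B] x /
   (law P A x.1 * law P B x.2)))) /mi !ent_sumT.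
rewrite opprK -opprD -big_split/= addrC -sumrB.
apply: eq_bigr => t _; have [->|Pt] := eqVneq (P t) 0; first by ring.
rewrite log2_div ?log2M ?mulr_gt0 ?law_gt0//.
by ring.
Qed.

Section Cond.
Variables (A_ B_ C_ : finType) (A : T -> A_) (B : T -> B_) (C : T -> C_).

Let p (x : A_ * B_ * C_) := law P [% [% A, B], C] x.
(** The law (A, B, C) would have with the same pairs (A, C), (B, C) and with A, B conditionally
    independent given C; [cmi] is the divergence of [p] from it. *)
Let q (x : A_ * B_ * C_) :=
  law P [% A, C] (x.1.1, x.2) * law P [% B, C] (x.1.2, x.2) / law P C x.2.

Lemma cond_mutual_infoE : cond_mutual_info P A B C = cmi A B C.
Proof.
rewrite /cond_mutual_info pair_big/= pair_big/=.
transitivity (\sum_x p x * log2 (claw P [% A, B] C x.1 x.2 /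
   (claw P A C x.1.1 x.2 * claw P B C x.1.2 x.2))).
  by apply: eq_bigr => -[[]].
rewrite sum_law /cmi !ent_sumT -!sumrN -!big_split/=.
apply: eq_bigr => t _; have [->|Pt] := eqVneq (P t) 0; first by ring.
have H1 := law_gt0 [% [% A, B], C] Pt.
have H2 := law_gt0 [% A, C] Pt.
have H3 := law_gt0 [% B, C] Pt.
have H4 := law_gt0 C Pt.
rewrite /claw !(log2_div, log2M) ?(mulr_gt0, divr_gt0, invr_gt0)//.
by ring.
Qed.

Lemma cmi_gibbs : cmi A B C = \sum_x p x * log2 (p x / q x).
Proof.
rewrite sum_law /cmi !ent_sumT -!sumrN -!big_split/=.
apply: eq_bigr => t _; have [->|Pt] := eqVneq (P t) 0; first by ring.
have H1 := law_gt0 [% [% A, B], C] Pt.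
have H2 := law_gt0 [% A, C] Pt.
have H3 := law_gt0 [% B, C] Pt.
have H4 := law_gt0 C Pt.
rewrite /p /q !(log2_div, log2M) ?(mulr_gt0, divr_gt0, invr_gt0)//.
by ring.
Qed.

Let p_ge0 x : 0 <= p x. Proof. exact: law_ge0. Qed.
Let q_ge0 x : 0 <= q x.
Proof. by rewrite /q divr_ge0 ?mulr_ge0 ?law_ge0. Qed.

Let q_dom x : q x = 0 -> p x = 0.
Proof.
case: x => -[a b] c /eqP; rewrite /q !mulf_eq0 invr_eq0 /= => /orP[/orP[]|] /eqP.
- exact: (@law_comp_eq0 _ _ [% [% A, B], C] (fun x => (x.1.1, x.2)) (a, b, c)).
- exact: (@law_comp_eq0 _ _ [% [% A, B], C] (fun x => (x.1.2, x.2)) (a, b, c)).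
- exact: (@law_comp_eq0 _ _ [% [% A, B], C] (fun x => x.2) (a, b, c)).
Qed.

Let sum_q : \sum_x q x <= \sum_x p x.
Proof.
rewrite sum_law1 -(sum_law1 C).
have -> : \sum_x q x = \sum_a \sum_b \sum_c q (a, b, c).
  by rewrite pair_big/= pair_big/=; apply: eq_bigr => -[[]].
rewrite exchange_big/=.
under eq_bigr do rewrite exchange_big/=.
rewrite exchange_big/=; apply: ler_sum => c _; rewrite /q /=.
under eq_bigr do rewrite -mulr_suml -mulr_suml law_pairl.
rewrite -mulr_suml -mulr_sumr law_pairl.
have [->|c0] := eqVneq (law P C c) 0; first by rewrite !mul0r.
by rewrite mulfK.
Qed.

Lemma cmi_ge0 : 0 <= cmi A B C.
Proof. by rewrite cmi_gibbs; exact: (gibbs_leif p_ge0 q_ge0 q_dom sum_q).1. Qed.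

(** The equality case of Gibbs, freed of divisions so that it also covers null values of C. *)
Lemma cmi_eq0P : cmi A B C = 0 <-> forall a b c,
  law P [% [% A, B], C] (a, b, c) * law P C c =
  law P [% A, C] (a, c) * law P [% B, C] (b, c).
Proof.
split=> [|H].
  rewrite cmi_gibbs => /(gibbs_leif p_ge0 q_ge0 q_dom sum_q).2 pq a b c.
  have := pq (a, b, c); rewrite /p /q/= => ->.
  have [c0|c0] := eqVneq (law P C c) 0; last by rewrite divfK.
  rewrite c0 mulr0; apply/esym/eqP; rewrite mulf_eq0; apply/orP; left.
  by apply/eqP/(@law_comp_eq0 _ _ [% A, C] snd (a, c)).
rewrite cmi_gibbs big1// => -[[a b] c] _; rewrite /p /q/= -H.
have [->|p0] := eqVneq (law P [% [% A, B], C] (a, b, c)) 0; first by rewrite mul0r.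
have c0 : law P C c != 0.
  apply: contra p0 => /eqP c0.
  by apply/eqP/(@law_comp_eq0 _ _ [% [% A, B], C] snd (a, b, c)).
by rewrite mulfK// divff// /log2 ln1 mul0r mulr0.
Qed.

End Cond.

Lemma markov_chainP (A_ B_ C_ : finType) (A : T -> A_) (B : T -> B_) (C : T -> C_) :
  markov_chain P A B C <-> cmi A C B = 0.
Proof.
have sw a b c : law P [% A, [% B, C]] (a, (b, c)) = law P [% [% A, C], B] (a, c, b).
  by apply: eq_bigl => t; rewrite !xpair_eqE -andbA [(B t == b) && _]andbC.
have sw2 b c : law P [% B, C] (b, c) = law P [% C, B] (c, b).
  by apply: eq_bigl => t; rewrite !xpair_eqE andbC.
rewrite cmi_eq0P; split=> [H a c b|H a b c]; last first.
  rewrite /claw sw sw2 => bc.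
  have b0 : law P B b != 0.
    apply: contra bc => /eqP b0.
    by apply/eqP/(@law_comp_eq0 _ _ [% C, B] snd (c, b)).
  by apply/eqP; rewrite eqr_div// H.
have [bc0|bc0] := eqVneq (law P [% B, C] (b, c)) 0.
  rewrite -sw2 bc0 mulr0 -sw.
  by rewrite (@law_comp_eq0 _ _ [% A, [% B, C]] snd (a, (b, c))) ?mul0r.
have := H a b c bc0; rewrite /claw => /eqP.
have b0 : law P B b != 0.
  apply: contra bc0 => /eqP b0.
  by apply/eqP/(@law_comp_eq0 _ _ [% B, C] fst (b, c)).
by rewrite eqr_div// sw sw2 => /eqP.
Qed.

End Law.

(** * Shannon inequalities, product sources, time sharing *)

Lemma log2_le (R : realType) (x y : R) : 0 < x -> x <= y -> log2 x <= log2 y.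
Proof.
move=> x0 xy; rewrite /log2 ler_pM2r ?invr_gt0 ?ln2_gt0//.
by rewrite ler_ln ?posrE// (lt_le_trans x0).
Qed.

Lemma log2_prod (R : realType) (I : finType) (F : I -> R) :
  (forall i, 0 < F i) -> log2 (\prod_i F i) = \sum_i log2 (F i).
Proof.
move=> F0; suff [_ ->] : 0 < \prod_i F i /\ log2 (\prod_i F i) = \sum_i log2 (F i).
  by [].
apply: (big_ind2 (fun x y => 0 < x /\ log2 x = y)) => //.
- by rewrite /log2 ln1 mul0r.
- by move=> x1 x2 y1 y2 [x0 <-] [y0 <-]; rewrite mulr_gt0// log2M.
Qed.

Definition determines (T : Type) (A_ B_ : Type) (A : T -> A_) (B : T -> B_) :=
  forall t t', A t = A t' -> B t = B t'.

Section Shannon.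
Variables (R : realType) (T : finType) (P : T -> R).
Hypothesis P_ge0 : forall t, 0 <= P t.

Lemma ent_det (A_ B_ : finType) (A : T -> A_) (B : T -> B_) :
  determines A B -> determines B A -> ent P A = ent P B.
Proof. by move=> AB BA; apply: ent_eqv => t t' _ _; apply/eqP/eqP; eauto. Qed.

Lemma ent_mono (A_ B_ : finType) (A : T -> A_) (B : T -> B_) :
  determines A B -> ent P B <= ent P A.
Proof.
move=> AB; rewrite !ent_sumT lerN2; apply: ler_sum => t _.
have [->|Pt] := eqVneq (P t) 0; first by rewrite !mul0r.
rewrite ler_wpM2l// log2_le ?law_gt0// /law big_mkcond [leRHS]big_mkcond/=.
by apply: ler_sum => t' _; case: eqP => [/AB ->|_]; [rewrite eqxx|case: ifP].
Qed.

(** This is I(A; B | C) >= 0, with C a common part of A and B and D anything recovered from both.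
    Later inequalities then only require checking what determines what. *)
Lemma ent_submod (A_ B_ C_ D_ : finType)
    (A : T -> A_) (B : T -> B_) (C : T -> C_) (D : T -> D_) :
  determines A C -> determines B C -> determines [% A, B] D ->
  ent P D + ent P C <= ent P A + ent P B.
Proof.
move=> AC BC ABD; have := cmi_ge0 P_ge0 A B C; rewrite /cmi.
have -> : ent P [% A, C] = ent P A.
  by apply: ent_det => t t' => [[]|/[dup] /AC -> ->].
have -> : ent P [% B, C] = ent P B.
  by apply: ent_det => t t' => [[]|/[dup] /BC -> ->].
have -> : ent P [% [% A, B], C] = ent P [% A, B].
  by apply: ent_det => t t' => [[-> ->]//|[/[dup] /AC -> -> ->]].
have := ent_mono ABD; lra.
Qed.

Hypothesis P1 : \sum_t P t = 1.

Lemma ent_le_log (A_ : finType) (A : T -> A_) : ent P A <= log2 #|A_|%:R.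
Proof.
have A0 : (0 < #|A_|)%N.
  rewrite lt0n; apply/negP => /eqP A0.
  have := oner_neq0 R; rewrite -P1 big1 ?eqxx// => t _.
  by have := card0_eq A0 (A t); rewrite inE.
have N0 : (0 : R) < #|A_|%:R by rewrite ltr0n.
have [| |||+ _] :=
  @gibbs_leif R A_ (law P A) (fun=> (#|A_|%:R)^-1).
- by move=> a; exact: law_ge0.
- by move=> _; rewrite invr_ge0 ltW.
- by move=> a /eqP; rewrite invr_eq0 gt_eqF.
- by rewrite sum_law1 P1 sumr_const -[_^-1 *+ _]mulr_natl divff ?gt_eqF.
have -> : \sum_a law P A a * log2 (law P A a / #|A_|%:R^-1) =
  log2 #|A_|%:R - ent P A.
  transitivity (\sum_a (law P A a * log2 #|A_|%:R + law P A a * log2 (law P A a)));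
    last first.
   by rewrite big_split/= -mulr_suml sum_law1 P1 mul1r /ent opprK.
  apply: eq_bigr => a _; have [->|a0] := eqVneq (law P A a) 0; first by rewrite !mul0r addr0.
  have aP : 0 < law P A a by rewrite lt_def a0 law_ge0.
  by rewrite invrK log2M//; ring.
by rewrite subr_ge0.
Qed.

Lemma ent_add_le (A_ B_ C_ : finType) (A : T -> A_) (B : T -> B_) (C : T -> C_) :
  determines [% A, B] C -> ent P C <= ent P A + log2 #|B_|%:R.
Proof.
move=> ABC; have := @ent_submod A_ B_ unit C_ A B (fun=> tt) C.
rewrite (ent_const P1 (a := tt))// => /(_ _ _ ABC).
have := ent_le_log B; have : determines A (fun=> tt) by [].
have : determines B (fun=> tt) by [].
by move=> h1 h2 h3 /(_ h2 h1); lra.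
Qed.

End Shannon.

Section Iid.
Variables (R : realType) (S : finType) (p : S -> R) (n : nat).
Hypothesis p_ge0 : forall x, 0 <= p x.
Hypothesis p1 : \sum_x p x = 1.

Let Q := iid_pmf p (n := n).

Lemma iid_ge0 s : 0 <= Q s.
Proof. exact: prodr_ge0. Qed.

Lemma iid_sum1 : \sum_s Q s = 1.
Proof.
by rewrite -(bigA_distr_bigA (fun _ => p)) big1.
Qed.

(** The map [h] may depend on the position because the masks of the single-letter argument do. *)
Lemma law_iid (B_ : finType) (h : 'I_n -> S -> B_) (a : {ffun 'I_n -> B_}) :
  law Q (fun s => [ffun i => h i (s i)]) a = \prod_i law p (h i) (a i).
Proof.
rewrite /law bigA_distr_big_dep; apply: eq_bigl => s.
apply/eqP/familyP => [<- i|H]; first by rewrite ffunE unfold_in eqxx.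
by apply/ffunP => i; rewrite ffunE; apply/eqP/(H i).
Qed.

Lemma sum_iid (i : 'I_n) (F : S -> R) : \sum_s Q s * F (s i) = \sum_x p x * F x.
Proof.
transitivity (\prod_(j < n) \sum_x (p x * (if j == i then F x else 1))).
  rewrite bigA_distr_bigA/=; apply: eq_bigr => s _.
  rewrite big_split/=; congr (_ * _); rewrite (bigD1 i)//= eqxx.
  by rewrite big1 ?mulr1// => j /negbTE ->.
rewrite (bigD1 i)//= eqxx [X in _ * X]big1 ?mulr1// => j /negbTE ->.
by under eq_bigr do rewrite mulr1.
Qed.

Lemma ent_iid (B_ : finType) (h : 'I_n -> S -> B_) :
  ent Q (fun s => [ffun i => h i (s i)]) = \sum_i ent p (h i).
Proof.
rewrite ent_sumT.
transitivity (- \sum_s Q s * \sum_i log2 (law p (h i) (h i (s i)))).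
  congr (- _); apply: eq_bigr => s _.
  have [->|Qs] := eqVneq (Q s) 0; first by rewrite !mul0r.
  congr (_ * _); rewrite law_iid.
  under eq_bigr do rewrite ffunE.
  apply: log2_prod => i; apply: law_gt0 => //.
  by move: Qs; rewrite /Q /iid_pmf prodf_seq_neq0 => /allP/(_ i); rewrite mem_index_enum; apply.
under eq_bigr do rewrite mulr_sumr.
rewrite exchange_big/= -sumrN; apply: eq_bigr => i _.
by rewrite (sum_iid i (fun x => log2 (law p (h i) (h i x)))) ent_sumT.
Qed.

Lemma law_iid1 (i : 'I_n) x : law Q (fun s => s i) x = p x.
Proof.
transitivity (\sum_s Q s * (s i == x)%:R).
  by rewrite /law big_mkcond/=; apply: eq_bigr => s _; case: eqP => _; rewrite (mulr1, mulr0).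
rewrite (sum_iid i (fun y => (y == x)%:R)) (bigD1 x)//= eqxx mulr1.
by rewrite big1 ?addr0// => y /negbTE ->; rewrite mulr0.
Qed.

End Iid.

Section TimeSharing.
Variables (R : realType) (T : finType) (P : T -> R) (n : nat).
Hypothesis P_ge0 : forall t, 0 <= P t.
Hypothesis P1 : \sum_t P t = 1.
Hypothesis n_gt0 : (0 < n)%N.

Definition time_shared (t : T * 'I_n) : R := P t.1 / n%:R.

Let n0 : (0 : R) < n%:R. Proof. by rewrite ltr0n. Qed.

Lemma time_shared_ge0 t : 0 <= time_shared t.
Proof. by rewrite divr_ge0 ?ler0n. Qed.

Lemma sum_time_shared (F : T -> 'I_n -> R) :
  \sum_t time_shared t * F t.1 t.2 = n%:R^-1 * \sum_q \sum_t P t * F t q.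
Proof.
rewrite exchange_big pair_big/= mulr_sumr; apply: eq_bigr => t _.
by rewrite /time_shared; ring.
Qed.

Lemma time_shared_sum1 : \sum_t time_shared t = 1.
Proof.
transitivity (\sum_t time_shared t * 1); first by under [RHS]eq_bigr do rewrite mulr1.
rewrite (sum_time_shared (fun _ _ => 1)).
under eq_bigr do under eq_bigr do rewrite mulr1.
under eq_bigr do rewrite P1.
by rewrite sumr_const card_ord mulVf// gt_eqF.
Qed.

Lemma law_time_shared (A_ : finType) (A : 'I_n -> T -> A_) q a :
  law time_shared (fun t => (t.2, A t.2 t.1)) (q, a) = law P (A q) a / n%:R.
Proof.
transitivity (\sum_t time_shared t * ((t.2 == q) && (A t.2 t.1 == a))%:R).
  rewrite /law big_mkcond/=; apply: eq_bigr => t _; rewrite xpair_eqE.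
  by case: andP => _; rewrite (mulr1, mulr0).
rewrite (sum_time_shared (fun t q' => ((q' == q) && (A q' t == a))%:R)).
rewrite (bigD1 q)//= [X in _ + X]big1 ?addr0; last first.
  by move=> j /negbTE ->; apply: big1 => t _; rewrite mulr0.
rewrite mulrC /law [\sum_(_ | _ == _) _]big_mkcond/=; congr (_ / _).
by apply: eq_bigr => t _; rewrite eqxx; case: eqP => _; rewrite (mulr1, mulr0).
Qed.

Lemma law_time_shared_avg (A_ : finType) (A : 'I_n -> T -> A_) a :
  law time_shared (fun t => A t.2 t.1) a = n%:R^-1 * \sum_q law P (A q) a.
Proof.
rewrite -(law_pairl time_shared snd) mulr_sumr; apply: eq_bigr => q _.
by rewrite law_time_shared mulrC.
Qed.

(** Chain rule for the uniform index. The term log2 n is common to all variables that carry the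
    index, so it cancels in their differences. *)
Lemma ent_time_shared (A_ : finType) (A : 'I_n -> T -> A_) :
  ent time_shared (fun t => (t.2, A t.2 t.1)) =
  log2 n%:R + n%:R^-1 * \sum_q ent P (A q).
Proof.
have E q : \sum_a law P (A q) a / n%:R * log2 (law P (A q) a / n%:R) =
    - (n%:R^-1 * (log2 n%:R + ent P (A q))).
  transitivity (- (n%:R^-1 *
      \sum_a (law P (A q) a * log2 n%:R - law P (A q) a * log2 (law P (A q) a)))).
    rewrite mulr_sumr -sumrN; apply: eq_bigr => a _.
    have [->|a0] := eqVneq (law P (A q) a) 0; first by rewrite !mul0r subr0 mulr0 oppr0.
    have aP : 0 < law P (A q) a by rewrite lt_def a0 law_ge0.
    by rewrite log2_div//; ring.
  by rewrite big_split/= -mulr_suml sum_law1 P1 mul1r sumrN /ent.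
rewrite {1}/ent; transitivity (- \sum_q \sum_a law P (A q) a / n%:R *
    log2 (law P (A q) a / n%:R)).
  by rewrite pair_big/=; congr (- _); apply: eq_bigr => -[q a] _; rewrite law_time_shared.
under eq_bigr do rewrite E; rewrite sumrN opprK -mulr_sumr big_split/= mulrDr.
by rewrite sumr_const card_ord -[log2 _ *+ _]mulr_natl mulKf// gt_eqF.
Qed.

End TimeSharing.

(** * Single-letterization *)

(* Which of the components X1, X2, Y of a source letter are observed. *)
Definition coords := (bool * bool * bool)%type.

Definition submask (b b' : coords) : Prop :=
  [/\ b.1.1 -> b'.1.1, b.1.2 -> b'.1.2 & b.2 -> b'.2].

Definition maskU (b b' : coords) : coords :=
  (b.1.1 || b'.1.1, b.1.2 || b'.1.2, b.2 || b'.2).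

(** Hidden components become [None], so that all masks yield observations of one type. *)
Definition sel (X1 X2 Y : Type) (b : coords) (s : X1 * X2 * Y) :
    option X1 * option X2 * option Y :=
  (if b.1.1 then Some s.1.1 else None, if b.1.2 then Some s.1.2 else None,
   if b.2 then Some s.2 else None).

Lemma selP (X1 X2 Y : Type) (b : coords) (s s' : X1 * X2 * Y) :
  sel b s = sel b s' <->
  [/\ b.1.1 -> s.1.1 = s'.1.1, b.1.2 -> s.1.2 = s'.1.2 & b.2 -> s.2 = s'.2].
Proof.
case: b => [[b1 b2] b3]; rewrite /sel/=; split=> [[]|[]].
  by case: b1 b2 b3 => [] [] [] // *; split=> // _; congruence.
by case: b1 b2 b3 => [] [] [] // h1 h2 h3; rewrite ?h1 ?h2 ?h3.
Qed.

Lemma sel_submaskU (X1 X2 Y : Type) (a b d : coords) (s s' : X1 * X2 * Y) :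
  submask d (maskU a b) -> sel a s = sel a s' -> sel b s = sel b s' ->
  sel d s = sel d s'.
Proof.
move=> [h1 h2 h3] /selP[a1 a2 a3] /selP[b1 b2 b3].
by apply/selP; split => [/h1|/h2|/h3] /orP[]; auto.
Qed.

Lemma sel_submask (X1 X2 Y : Type) (a b : coords) :
  submask b a -> determines (@sel X1 X2 Y a) (sel b).
Proof.
move=> ba s s' ss'; apply: sel_submaskU (ss') (ss').
by case: ba => h1 h2 h3; split=> /= /[dup] => [/h1|/h2|/h3] ->.
Qed.

Section Converse.
Variables (R : realType) (X1 X2 Y : finType).
Local Notation S := (X1 * X2 * Y)%type.
Variables (p : S -> R) (n : nat).
Hypothesis p_ge0 : forall x, 0 <= p x.
Hypothesis p1 : \sum_x p x = 1.

Let e (b : coords) : R := ent p (sel b).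

Hypothesis p_markov :
  e (true, false, true) + e (false, true, true) =
  e (true, true, true) + e (false, false, true).

Let Q := iid_pmf p (n := n).
Let Q_ge0 s : 0 <= Q s. Proof. exact: iid_ge0. Qed.

Definition obs (m : nat -> coords) (s : {ffun 'I_n -> S}) :=
  [ffun i : 'I_n => sel (m i) (s i)].

Variables (M : finType) (msg : nat -> {ffun 'I_n -> S} -> M).

Definition transcript (T B_ : finType) (U : nat -> T -> B_) (j : nat) (s : T) :=
  [ffun i : 'I_j => U i s].

Lemma transcript_le (T B_ : finType) (U : nat -> T -> B_) j j' :
  (j' <= j)%N -> determines (transcript U j) (transcript U j').
Proof.
move=> le s s' /ffunP H; apply/ffunP => i.
by have := H (widen_ord le i); rewrite !ffunE.
Qed.

Lemma transcriptS (T B_ : finType) (U : nat -> T -> B_) j :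
  determines [% transcript U j, U j] (transcript U j.+1).
Proof.
move=> s s' [/ffunP H Us]; apply/ffunP => i; rewrite !ffunE.
have [lt|ge] := ltnP i j; first by have := H (Ordinal lt); rewrite !ffunE.
by have -> : i = j :> nat by have := ltn_ord i; lia.
Qed.

Lemma transcript_last (T B_ : finType) (U : nat -> T -> B_) j :
  determines (transcript U j.+1) (U j).
Proof.
by move=> s s' /ffunP /(_ ord_max); rewrite !ffunE.
Qed.

Local Notation tr := (transcript msg).
Let H (m : nat -> coords) (j : nat) : R := ent Q [% obs m, tr j].

Hypothesis msg_even : forall j, ~~ odd j ->
  determines [% obs (fun=> (true, false, false)), tr j] (msg j).
Hypothesis msg_odd : forall j, odd j ->
  determines [% obs (fun=> (false, true, false)), tr j] (msg j).
Variable c : nat -> R.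
(** The only trace of the message alphabets: for a code, [c j] is the logarithm of the size of the
    message set of round [j]. *)
Hypothesis msg_size : forall m j, H m j.+1 <= H m j + c j.

Definition submasks (m m' : nat -> coords) :=
  forall i, (i < n)%N -> submask (m i) (m' i).

Lemma obs_submaskU a b d : submasks d (fun i => maskU (a i) (b i)) ->
  determines [% obs a, obs b] (obs d).
Proof.
move=> dab s s' [/ffunP ha /ffunP hb]; apply/ffunP => i.
have := ha i; have := hb i; rewrite !ffunE => hb' ha'.
exact: sel_submaskU (dab i _) ha' hb'.
Qed.

Lemma obs_submask a b : submasks b a -> determines (obs a) (obs b).
Proof.
move=> ba s s' /ffunP ss'; apply/ffunP => i; have := ss' i; rewrite !ffunE.
exact/sel_submask/ba.
Qed.

Lemma H_mono a b j k : submasks b a -> (k <= j)%N -> H b k <= H a j.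
Proof.
move=> ba kj; apply: ent_mono => // s s' [/(obs_submask ba) ->].
by move=> /(transcript_le kj) ->.
Qed.

Lemma H_eq a b j : (forall i, (i < n)%N -> a i = b i) -> H a j = H b j.
Proof.
by move=> ab; apply/eqP; rewrite eq_le !H_mono// => i /ab ->.
Qed.

Lemma H_submod a b d g ja jb jd jg :
  submasks g a -> submasks g b -> submasks d (fun i => maskU (a i) (b i)) ->
  (jg <= ja)%N -> (jg <= jb)%N -> (jd <= maxn ja jb)%N ->
  H d jd + H g jg <= H a ja + H b jb.
Proof.
move=> ga gb dab lea leb led; apply: ent_submod => //.
- by move=> s s' [/(obs_submask ga) -> /(transcript_le lea) ->].
- by move=> s s' [/(obs_submask gb) -> /(transcript_le leb) ->].
move=> s s' [ha ta hb tb].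
have <- : obs d s = obs d s' by apply: (obs_submaskU dab); rewrite ha hb.
congr pair; move: led; rewrite leq_max => /orP[] le.
  exact: transcript_le le _ _ ta.
exact: transcript_le le _ _ tb.
Qed.

(** A message of the first encoder is a function of the X1 block and of the past, hence free once
    every X1 letter is visible. *)
Lemma H_even (a : nat -> coords) j : ~~ odd j -> (forall i, (i < n)%N -> (a i).1.1) ->
  H a j.+1 = H a j.
Proof.
move=> oj ha; apply: ent_det => // s s' [os ts].
  by rewrite os (transcript_le _ ts).
rewrite os; congr pair; apply: transcriptS; rewrite ts; congr pair.
apply: (msg_even oj); rewrite ts; congr pair; apply: (obs_submask _ os).
by move=> i /ha ai; split.
Qed.

Lemma H_odd (a : nat -> coords) j : odd j -> (forall i, (i < n)%N -> (a i).1.2) ->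
  H a j.+1 = H a j.
Proof.
move=> oj ha; apply: ent_det => // s s' [os ts].
  by rewrite os (transcript_le _ ts).
rewrite os; congr pair; apply: transcriptS; rewrite ts; congr pair.
apply: (msg_odd oj); rewrite ts; congr pair; apply: (obs_submask _ os).
by move=> i /ha ai; split.
Qed.

Lemma H_both (a : nat -> coords) j : (forall i, (i < n)%N -> (a i).1.1) ->
  (forall i, (i < n)%N -> (a i).1.2) -> H a j = H a 0.
Proof.
move=> h1 h2; elim: j => // j <-.
by case: (boolP (odd j)) => oj; [exact: H_odd|exact: H_even].
Qed.

Lemma H0 a : H a 0 = \sum_(i < n) e (a i).
Proof.
transitivity (ent Q (obs a)); last exact: ent_iid.
apply: ent_det => // s s' => [[]//|->]; congr pair.
by apply/ffunP => -[].
Qed.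

(* I(A; B | C) = 0 survives conditioning on a transcript in which every message
   is a function of its past and of either (A, C) or (B, C). *)
Lemma rectangle (a b d g : nat -> coords) j :
  submasks g a -> submasks g b -> submasks d (fun i => maskU (a i) (b i)) ->
  submasks a d -> submasks b d ->
  (forall i, (i < n)%N -> (a i).1.1) -> (forall i, (i < n)%N -> (b i).1.2) ->
  H a 0 + H b 0 = H d 0 + H g 0 -> H a j + H b j = H d j + H g j.
Proof.
move=> ga gb dab ad bd ha hb H00; elim: j => // j IHj.
have hd1 i : (i < n)%N -> (d i).1.1 by move=> /[dup]/ha hi /ad[/(_ hi)].
have hd2 i : (i < n)%N -> (d i).1.2 by move=> /[dup]/hb hi /bd[_ /(_ hi)].
have sub k : (k <= j.+1)%N -> H d j.+1 + H g k <= H a j.+1 + H b k.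
  by move=> kj; apply: H_submod => //; rewrite leq_max leqnn.
have sub' k : (k <= j.+1)%N -> H d j.+1 + H g k <= H a k + H b j.+1.
  by move=> kj; apply: H_submod => //; rewrite leq_max leqnn orbT.
have gg : submasks g g by [].
have bU : submasks b (fun i => maskU (g i) (b i)).
  by move=> i _; split => /= ->; rewrite orbT.
have aU : submasks a (fun i => maskU (g i) (a i)).
  by move=> i _; split => /= ->; rewrite orbT.
have max1 : (j.+1 <= maxn j.+1 j)%N by rewrite leq_max leqnn.
have subb := @H_submod g b b g j.+1 j j.+1 j gg gb bU (leqnSn _) (leqnn _) max1.
have suba := @H_submod g a a g j.+1 j j.+1 j gg ga aU (leqnSn _) (leqnn _) max1.
have := sub j.+1 (leqnn _).
case: (boolP (odd j)) => oj.
  rewrite !(H_odd oj hb) !(H_odd oj hd2); lra.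
rewrite !(H_even oj ha) !(H_even oj hd1); lra.
Qed.

Lemma telescope_ord (f : nat -> R) :
  \sum_(q < n) (f q.+1 - f q) = f n - f 0.
Proof. by rewrite -(big_mkord xpredT (fun q => f q.+1 - f q)) telescope_sumr. Qed.

Lemma telescope_ord_rev (f : nat -> R) :
  \sum_(q < n) (f q - f q.+1) = f 0 - f n.
Proof.
by rewrite -[RHS]opprB -telescope_ord -sumrN; apply: eq_bigr => q _; rewrite opprB.
Qed.

(* The single-letter auxiliary variable at time q is the transcript together
   with Y_i for i < q and X2_i for i > q; [b] tells what is seen of letter q. *)
Definition aux_mask (q : nat) (b : coords) (i : nat) : coords :=
  if i == q then b else (false, (q < i)%N, (i < q)%N).

Let h (q : nat) b j := H (aux_mask q b) j.

Ltac masks :=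
  let i := fresh "i" in move=> i ?; rewrite /aux_mask /maskU /=;
  try (case: (i =P _) => ?); split => /=; lia.

Let y_ : nat -> coords := fun=> (false, false, true).
Let none_ : nat -> coords := fun=> (false, false, false).
Let x2_ : nat -> coords := fun=> (false, true, false).
Let x12_ : nat -> coords := fun=> (true, true, false).
Let x1y_ : nat -> coords := fun=> (true, false, true).
Let x2y_ : nat -> coords := fun=> (false, true, true).
Let all_ : nat -> coords := fun=> (true, true, true).

(** Chain rule over increasing q, then X2_i for i > q joins the conditioning of Y_q. Any prefix is
    allowed, since the relevance bound uses the whole transcript and the R2 bound the one without
    the last message. *)
Lemma relevance_le j :
  H y_ 0 + H none_ j - H y_ j <=
  \sum_(q < n) (e (false, false, true) + h q (false, false, false) j
                - h q (false, false, true) j).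
Proof.
pose f k := H (fun i => (false, false, (i < k)%N)) j.
have -> : H y_ j = f n by apply: H_eq => i /= ->.
have -> : H none_ j = f 0 by apply: H_eq.
rewrite H0 -addrA -opprB -telescope_ord -sumrB; apply: ler_sum => q _.
have : h q (false, false, true) j + f q <= f q.+1 + h q (false, false, false) j.
  by apply: H_submod; rewrite ?maxnn//; masks.
rewrite /y_; lra.
Qed.

(* The letters Y_i, i < q, can be added for free: given X1_i and X2_i for i < q
   they are independent of the other letters, hence of the transcript. *)
Lemma rate1_telescope j :
  \sum_(q < n) (h q (false, true, false) j - h q (true, true, false) j) <=
  H x2_ j - H x12_ j.
Proof.
pose f k := H (fun i => ((i < k)%N, true, false)) j.
have -> : H x12_ j = f n by apply: H_eq => i /= ->.
have -> : H x2_ j = f 0 by apply: H_eq.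
rewrite -telescope_ord_rev; apply: ler_sum => q _.
pose g k l i : coords := ((i < k)%N, true, (i < l)%N).
pose g' l i : coords := (true, true, (i < l)%N).
pose f' k i : coords := ((i < k)%N, true, false).
(* The conditional entropy of Y_i, i < q, given all X2, the messages and X1 before q is at most its
   value without messages ([i1]). Given X1 up to q it is at least its value given all X1 and X2
   ([i2]), where messages are free. The two reference values agree ([i4]). *)
have i1 : H (g q q) j + H (f' q) 0 <= H (g q q) 0 + H (f' q) j.
  by apply: H_submod; rewrite ?max0n//; masks.
have i2 : H (g' q) j + H (f' q.+1) j <= H (g q.+1 q) j + H x12_ j.
  by apply: H_submod; rewrite ?maxnn//; masks.
(* X1_i and X2_i, i < q, are dropped from the conditioning of X1_q, which leaves the auxiliary
   variable and X2_q. *)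
have i3 : H (g q.+1 q) j + h q (false, true, false) j <=
    H (g q q) j + h q (true, true, false) j.
  by apply: H_submod; rewrite ?maxnn//; masks.
have i4 : H (g' q) 0 - H x12_ 0 = H (g q q) 0 - H (f' q) 0.
  rewrite !H0 -!sumrB; apply: eq_bigr => i _; rewrite /g' /g /f' /x12_.
  by case: (i < q)%N => //; rewrite !subrr.
have i5 : H (g' q) j = H (g' q) 0 by apply: H_both.
have i6 : H x12_ j = H x12_ 0 by apply: H_both.
have -> : f q = H (f' q) j by [].
have -> : f q.+1 = H (f' q.+1) j by [].
lra.
Qed.

(** Here [f k] shows all of Y and the letters from k on, so one increment is the entropy of letter q
    given Y and the later letters; forgetting Y_i and X1_i for i > q raises it. The flag [b] serves
    both I(X2; M | Y) and I(X1 X2; M | Y). *)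
Lemma backward_telescope b j :
  \sum_(q < n) (h q (false, false, true) j - h q (b, true, true) j) <=
  H y_ j - H (fun=> (b, true, true)) j.
Proof.
pose f k := H (fun i => (b && (k <= i)%N, (k <= i)%N, true)) j.
have -> : H (fun=> (b, true, true)) j = f 0.
  by apply: H_eq => i _; rewrite leq0n andbT.
have -> : H y_ j = f n by apply: H_eq => i; rewrite ltnNge => /negbTE ->; rewrite andbF.
rewrite -telescope_ord; apply: ler_sum => q _.
have : f q + h q (false, false, true) j <= f q.+1 + h q (b, true, true) j.
  by apply: H_submod; rewrite ?maxnn//; masks.
lra.
Qed.

(** Given the X2 block the odd messages are free, so only the first encoder is charged. *)
Lemma rate1_messages k :
  H x2_ k.*2 - H x2_ 0 <= \sum_(i < k) c i.*2.
Proof.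
elim: k => [|k IHk]; first by rewrite big_ord0 subrr.
rewrite big_ord_recr/= doubleS H_odd ?oddS ?odd_double//.
by have := msg_size x2_ k.*2; lra.
Qed.

Lemma rate2_messages k :
  H x1y_ k.*2 - H x1y_ 0 <= \sum_(i < k) c i.*2.+1.
Proof.
elim: k => [|k IHk]; first by rewrite big_ord0 subrr.
rewrite big_ord_recr/= doubleS.
have := msg_size x1y_ k.*2.+1; rewrite (@H_even _ k.*2) ?odd_double//.
lra.
Qed.

Lemma sum_rate_messages k :
  H none_ k.*2 <= \sum_(i < k) c i.*2 + \sum_(i < k) c i.*2.+1.
Proof.
elim: k => [|k IHk].
  rewrite !big_ord0 addr0 H0 big1// => i _.
  by rewrite /e/= (ent_const p1 (a := (None, None, None))).
rewrite !big_ord_recr/= doubleS.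
have := msg_size none_ k.*2.+1; have := msg_size none_ k.*2.
lra.
Qed.

Lemma rate1_le k :
  \sum_(q < n) (e (true, true, false) - e (false, true, false)
     + h q (false, true, false) k.*2 - h q (true, true, false) k.*2)
  <= \sum_(i < k) c i.*2.
Proof.
have := rate1_messages k; have := rate1_telescope k.*2.
have -> : H x12_ k.*2 = H x12_ 0 by apply: H_both.
have : H x12_ 0 - H x2_ 0 = \sum_(q < n) (e (true, true, false) - e (false, true, false)).
  by rewrite !H0 sumrB.
have -> : \sum_(q < n) (e (true, true, false) - e (false, true, false)
     + h q (false, true, false) k.*2 - h q (true, true, false) k.*2) =
   \sum_(q < n) (e (true, true, false) - e (false, true, false)) +
   \sum_(q < n) (h q (false, true, false) k.*2 - h q (true, true, false) k.*2).
  by rewrite -big_split/=; apply: eq_bigr => q _; rewrite addrA.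
lra.
Qed.

(** The mutual information of the Y block and the first [j] messages. *)
Let iota j := H y_ 0 + H none_ j - H y_ j.

(** Together with [H all_ j = H all_ 0], this turns I(X2; M | Y) into H(M | X1, Y), to which only
    the second encoder contributes. *)
Lemma rectangle_Y j : H x1y_ j + H x2y_ j = H all_ j + H y_ j.
Proof.
apply: rectangle => //; try masks.
by rewrite !H0 -!big_split/=; apply: eq_bigr => i _.
Qed.

(** All messages of the second encoder but the last are charged given (X1, Y). The last one, J, is
    charged given the past alone, and this pays in addition for the relevance gained by it, I(Y; J |
    past); that gain is the source of the terms - I(Y; W2) + mu. *)
Lemma rate2_le k :
  \sum_(q < n) (e (false, true, true) - e (false, false, true)
     + h q (false, false, true) k.+1.*2 - h q (false, true, true) k.+1.*2
     - (e (false, false, true) + h q (false, false, false) k.*2.+1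
                - h q (false, false, true) k.*2.+1)) + iota k.+1.*2
  <= \sum_(i < k.+1) c i.*2.+1.
Proof.
rewrite big_split/= sumrN.
have := relevance_le k.*2.+1; have := backward_telescope false k.+1.*2.
have := rectangle_Y k.+1.*2; have := rectangle_Y 0.
have -> : H all_ k.+1.*2 = H all_ 0 by apply: H_both.
have := rate2_messages k; rewrite -(@H_even x1y_ k.*2) ?odd_double//.
(* H(J | X1, Y, past) <= H(J | Y, past) for the last message J. *)
have : H x1y_ k.+1.*2 + H y_ k.*2.+1 <= H x1y_ k.*2.+1 + H y_ k.+1.*2.
  by apply: H_submod; rewrite ?doubleS ?leq_max ?leqnn ?orbT//; masks.
have := msg_size none_ k.*2.+1; rewrite /iota.
have : H x2y_ 0 - H y_ 0 = \sum_(q < n) (e (false, true, true) - e (false, false, true)).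
  by rewrite !H0 sumrB.
have -> : \sum_(q < n) (e (false, true, true) - e (false, false, true)
     + h q (false, false, true) k.+1.*2 - h q (false, true, true) k.+1.*2) =
   \sum_(q < n) (e (false, true, true) - e (false, false, true)) +
   \sum_(q < n) (h q (false, false, true) k.+1.*2 - h q (false, true, true) k.+1.*2).
  by rewrite -big_split/=; apply: eq_bigr => q _; rewrite addrA.
rewrite big_ord_recr/= -/x2y_ doubleS; lra.
Qed.

Lemma sum_rate_le k :
  \sum_(q < n) (e (true, true, true) - e (false, false, true)
     + h q (false, false, true) k.*2 - h q (true, true, true) k.*2) + iota k.*2
  <= \sum_(i < k) c i.*2 + \sum_(i < k) c i.*2.+1.
Proof.
have := sum_rate_messages k; have := backward_telescope true k.*2.
rewrite -/all_ /iota; have -> : H all_ k.*2 = H all_ 0 by apply: H_both.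
have : H all_ 0 - H y_ 0 = \sum_(q < n) (e (true, true, true) - e (false, false, true)).
  by rewrite !H0 sumrB.
have -> : \sum_(q < n) (e (true, true, true) - e (false, false, true)
     + h q (false, false, true) k.*2 - h q (true, true, true) k.*2) =
   \sum_(q < n) (e (true, true, true) - e (false, false, true)) +
   \sum_(q < n) (h q (false, false, true) k.*2 - h q (true, true, true) k.*2).
  by rewrite -big_split/=; apply: eq_bigr => q _; rewrite addrA.
lra.
Qed.

(** The observation [a] contains the X1 block, which produces the message, and [b] contains the
    letters X2_q and Y_q; their overlap is X1_q with the side letters of the auxiliary variable.
    Given it they are independent: for i < q by the source chain, for i >= q because one of them
    adds nothing. By [rectangle] the transcript preserves this. *)
Lemma aux_even q j : (q < n)%N -> ~~ odd j ->
  h q (true, false, false) j.+1 + h q (true, true, true) j =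
  h q (true, true, true) j.+1 + h q (true, false, false) j.
Proof.
move=> qn oj.
pose a i : coords := (true, (q < i)%N, (i < q)%N).
pose b i : coords := ((i == q)%N, true, (i <= q)%N).
pose d i : coords := (true, true, (i <= q)%N).
have rect k : H a k + H b k = H d k + h q (true, false, false) k.
  apply: rectangle => //; try by rewrite /a /b /d; masks.
  rewrite !H0 -!big_split/=; apply: eq_bigr => i _; rewrite /a /b /d /aux_mask.
  by case: (ltngtP i q) => _ //=; rewrite addrC.
have := rect j; have := rect j.+1.
rewrite (@H_even a j)// (@H_even d j)//.
have : h q (true, true, true) j.+1 + h q (true, false, false) j <=
    h q (true, false, false) j.+1 + h q (true, true, true) j.
  by apply: H_submod; rewrite ?leq_max ?leqnn//; masks.
(* Back from the block [b] to the single letter q: conditioning on more only lowers the entropy of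
   the message. *)
have : H b j.+1 + h q (true, true, true) j <= h q (true, true, true) j.+1 + H b j.
  by apply: H_submod; rewrite ?leq_max ?leqnn//; rewrite /b; masks.
lra.
Qed.

(** As in [aux_even] with the roles exchanged: [b] produces the message, [a] contains X1_q and Y_q,
    and the overlap holds X2_q. *)
Lemma aux_odd q j : (q < n)%N -> odd j ->
  h q (false, true, false) j.+1 + h q (true, true, true) j =
  h q (true, true, true) j.+1 + h q (false, true, false) j.
Proof.
move=> qn oj.
pose a i : coords := (true, (q <= i)%N, (i <= q)%N).
pose b i : coords := (false, true, (i < q)%N).
pose d i : coords := (true, true, (i <= q)%N).
have rect k : H a k + H b k = H d k + h q (false, true, false) k.
  apply: rectangle => //; try by rewrite /a /b /d; masks.
  rewrite !H0 -!big_split/=; apply: eq_bigr => i _; rewrite /a /b /d /aux_mask.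
  by case: (ltngtP i q) => _ //=.
have := rect j; have := rect j.+1.
rewrite (@H_odd b j)// (@H_odd d j)//.
have : h q (true, true, true) j.+1 + h q (false, true, false) j <=
    h q (false, true, false) j.+1 + h q (true, true, true) j.
  by apply: H_submod; rewrite ?leq_max ?leqnn//; masks.
have : H a j.+1 + h q (true, true, true) j <= h q (true, true, true) j.+1 + H a j.
  by apply: H_submod; rewrite ?leq_max ?leqnn//; rewrite /a; masks.
lra.
Qed.

Lemma aux0 q b b' : (q < n)%N -> h q b 0 - h q b' 0 = e b - e b'.
Proof.
move=> qn; have E b1 : h q b1 0 = e b1 +
    \sum_(i < n | i != Ordinal qn) e (false, (q < i)%N, (i < q)%N).
  rewrite /h H0 (bigD1 (Ordinal qn))//= /aux_mask eqxx; congr (_ + _).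
  by apply: eq_bigr => i; rewrite -val_eqE/= => /negbTE ->.
by rewrite !E; lra.
Qed.

End Converse.

(** * From codes to auxiliary variables *)

Definition aux_ent (R : realType) (T X1 X2 Y B_ : finType) (P : T -> R)
    (Src : T -> X1 * X2 * Y) (U : nat -> T -> B_) (b : coords) (m : nat) : R :=
  ent P [% sel b \o Src, transcript U m].

(** The letter known to the encoder that speaks at step [m]. *)
Definition step_mask (m : nat) : coords := (~~ odd m, odd m, false).

(* The auxiliary variables are interleaved: [U l.*2] and [U l.*2.+1] are V1 l and
   V2 l, so that [transcript U m] is W1 or W2 according to the parity of m. All
   information quantities and Markov chains are written with joint entropies. *)
Definition aux_sol (R : realType) (X1 X2 Y : finType) (p : X1 * X2 * Y -> R)
    (K : nat) (R1 R2 mu : R) (T B_ : finType) (P : T -> R)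
    (Src : T -> X1 * X2 * Y) (U : nat -> T -> B_) : Prop :=
  let G := aux_ent P Src U in
  let M := K.*2 in
  [/\ is_pmf P, law P Src =1 p,
    [/\ G (true, true, false) 0 - G (false, true, false) 0
          + G (false, true, false) M - G (true, true, false) M <= R1,
        G (false, true, true) 0 - G (false, false, true) 0
          + G (false, false, true) M - G (false, true, true) M
          - (G (false, false, true) 0 + G (false, false, false) M.-1
             - G (false, false, true) M.-1) + mu <= R2,
        G (true, true, true) 0 - G (false, false, true) 0
          + G (false, false, true) M - G (true, true, true) M + mu <= R1 + R2 &
        mu <= G (false, false, true) 0 + G (false, false, false) M
          - G (false, false, true) M] &
    forall m, (m < M)%N ->
      G (step_mask m) m.+1 + G (true, true, true) m =
      G (true, true, true) m.+1 + G (step_mask m) m].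

Lemma ent_law (R : realType) (T A_ B_ : finType) (P : T -> R) (A : T -> A_)
    (f : A_ -> B_) : ent P (f \o A) = ent (law P A) f.
Proof. by congr (- _); apply: eq_bigr => b _; rewrite law_law. Qed.

Lemma eq_ent (R : realType) (T A_ : finType) (P P' : T -> R) (A : T -> A_) :
  P =1 P' -> ent P A = ent P' A.
Proof.
move=> PP; have E a : law P A a = law P' A a by apply: eq_bigr => t _.
by congr (- _); apply: eq_bigr => b _; rewrite E.
Qed.

Lemma source_ent (R : realType) (T X1 X2 Y B_ : finType) (P : T -> R)
    (p : X1 * X2 * Y -> R) (Src : T -> X1 * X2 * Y) (U : nat -> T -> B_) b :
  (forall t, 0 <= P t) -> law P Src =1 p -> aux_ent P Src U b 0 = ent p (sel b).
Proof.
move=> P_ge0 srcp; rewrite -(eq_ent _ srcp) -ent_law; apply: ent_det => // s s'.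
  exact: (congr1 fst).
by move=> ss; congr pair => //; apply/ffunP => -[].
Qed.

(* A random variable seen as the partition it induces: this gives messages over
   different alphabets a common type without changing any entropy. *)
Definition cell (T A_ : finType) (A : T -> A_) (t : T) : {set T} :=
  [set t' | A t' == A t].

Lemma cell_det (T A_ : finType) (A : T -> A_) : determines (cell A) A.
Proof. by move=> t t' /setP/(_ t); rewrite !inE eqxx => /esym/eqP. Qed.

Lemma det_cell (T A_ : finType) (A : T -> A_) : determines A (cell A).
Proof. by move=> t t' tt'; apply/setP => x; rewrite !inE tt'. Qed.

Section CodeMessages.
Variables (X1 X2 Y : finType) (n : nat) (c : cdib_code X1 X2 n).
Local Notation S := (X1 * X2 * Y)%type.
Implicit Types s : {ffun 'I_n -> S}.

Let msgs l s := messages c (blockwise (@srcX1 X1 X2 Y) s)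
                           (blockwise (@srcX2 X1 X2 Y) s) l.
Let I_ l s := @code_f _ _ _ c l (blockwise (@srcX1 X1 X2 Y) s) (msgs l s).2.
Let J_ l s := @code_g _ _ _ c l (blockwise (@srcX2 X1 X2 Y) s)
  ((msgs l s).1, I_ l s : ord_alphabet (code_nI c) l).

Lemma messagesS l s :
  msgs l.+1 s = (((msgs l s).1, I_ l s), ((msgs l s).2, J_ l s)).
Proof. by rewrite /J_ /I_ /msgs /=; case: messages. Qed.

Definition code_msg (j : nat) : {ffun 'I_n -> S} -> {set {ffun 'I_n -> S}} :=
  if odd j then cell (J_ j./2) else cell (I_ j./2).

Definition code_size (j : nat) : nat :=
  if odd j then code_nJ c j./2 else code_nI c j./2.

Lemma code_msg_double l : code_msg l.*2 = cell (I_ l).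
Proof. by rewrite /code_msg odd_double doubleK. Qed.

Lemma code_msg_doubleS l : code_msg l.*2.+1 = cell (J_ l).
Proof. by rewrite /code_msg oddS odd_double/= uphalf_double. Qed.

Local Notation tr := (transcript code_msg).

Lemma transcript_messages l : determines (tr l.*2) (msgs l).
Proof.
elim: l => // l IHl s s'; rewrite doubleS => tt'.
have t1 := transcript_le (leqnSn _) tt'.
have := transcript_last tt'; rewrite code_msg_doubleS => /cell_det JJ.
have := transcript_last t1; rewrite code_msg_double => /cell_det II.
by rewrite !messagesS JJ II (IHl _ _ (transcript_le (leqnSn _) t1)).
Qed.

Lemma messages_transcript l : determines (msgs l) (tr l.*2).
Proof.
elim: l => [|l IHl] s s'; first by move=> _; apply/ffunP => -[].
rewrite !messagesS => -[] m1 II m2 JJ.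
have tt : tr l.*2 s = tr l.*2 s'.
  by apply: IHl; rewrite [LHS]surjective_pairing m1 m2 -surjective_pairing.
rewrite doubleS; apply/transcriptS; congr pair.
  apply/transcriptS; congr pair => //.
  by rewrite code_msg_double; exact: det_cell.
by rewrite code_msg_doubleS; exact: det_cell.
Qed.

Let x1_obs s s' :
  obs (fun=> (true, false, false)) s = obs (fun=> (true, false, false)) s' ->
  blockwise (@srcX1 X1 X2 Y) s = blockwise (@srcX1 X1 X2 Y) s'.
Proof.
move=> /ffunP H; apply/ffunP => i; rewrite !ffunE.
by have := H i; rewrite !ffunE => -[].
Qed.

Let x2_obs s s' :
  obs (fun=> (false, true, false)) s = obs (fun=> (false, true, false)) s' ->
  blockwise (@srcX2 X1 X2 Y) s = blockwise (@srcX2 X1 X2 Y) s'.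
Proof.
move=> /ffunP H; apply/ffunP => i; rewrite !ffunE.
by have := H i; rewrite !ffunE => -[].
Qed.

Lemma code_msg_even j : ~~ odd j ->
  determines [% obs (fun=> (true, false, false)), tr j] (code_msg j).
Proof.
move=> oj s s' [/x1_obs ss' tt']; rewrite /code_msg (negbTE oj); apply: det_cell.
rewrite /I_ ss' (_ : msgs j./2 s = msgs j./2 s')//.
by apply: transcript_messages; rewrite even_halfK.
Qed.

Lemma code_msg_odd j : odd j ->
  determines [% obs (fun=> (false, true, false)), tr j] (code_msg j).
Proof.
move=> oj s s' [/x2_obs ss' tt']; rewrite /code_msg oj; apply: det_cell.
have jE : j = j./2.*2.+1 by rewrite odd_halfK// prednK//; case: j oj {tt'}.
rewrite jE in tt'; have := transcript_last tt'; rewrite code_msg_double => /cell_det II.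
rewrite /J_ ss' II (_ : msgs j./2 s = msgs j./2 s')//.
exact: transcript_messages (transcript_le (leqnSn _) tt').
Qed.

Lemma code_msg_size (R : realType) (P : {ffun 'I_n -> S} -> R) m j :
  (forall s, 0 <= P s) -> \sum_s P s = 1 ->
  ent P [% obs m, tr j.+1] <= ent P [% obs m, tr j] + log2 (code_size j)%:R.
Proof.
move=> P_ge0 P1; rewrite /code_size; case: ifP => oj.
  rewrite -[X in _ + log2 X%:R]card_ord.
  apply: (@ent_add_le _ _ P P_ge0 P1 _ _ _ _ (J_ j./2)) => s s' [mm tt' JJ].
  congr pair => //; apply: transcriptS; congr pair => //.
  by rewrite /code_msg oj; apply: det_cell.
rewrite -[X in _ + log2 X%:R]card_ord.
apply: (@ent_add_le _ _ P P_ge0 P1 _ _ _ _ (I_ j./2)) => s s' [mm tt' II].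
congr pair => //; apply: transcriptS; congr pair => //.
by rewrite /code_msg oj; apply: det_cell.
Qed.

Lemma code_mutual_info (R : realType) (P : {ffun 'I_n -> S} -> R) K :
  (forall s, 0 <= P s) ->
  mutual_info P (blockwise (@srcY X1 X2 Y) (n := n)) (msgs K) =
  ent P [% obs (fun=> (false, false, true)), tr 0]
  + ent P [% obs (fun=> (false, false, false)), tr K.*2]
  - ent P [% obs (fun=> (false, false, true)), tr K.*2].
Proof.
move=> P_ge0; rewrite mutual_infoE// /mi.
have yo : determines (blockwise (@srcY X1 X2 Y) (n := n))
     (@obs X1 X2 Y n (fun=> (false, false, true))).
  move=> s s' /ffunP H; apply/ffunP => i; have := H i; rewrite !ffunE /sel/=.
  by rewrite /srcY => ->.
have oy : determines (@obs X1 X2 Y n (fun=> (false, false, true)))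
     (blockwise (@srcY X1 X2 Y) (n := n)).
  move=> s s' /ffunP H; apply/ffunP => i; rewrite !ffunE.
  by have := H i; rewrite !ffunE => -[].
congr (_ + _ - _).
- apply: ent_det => // s s' => [/yo ->|[/oy]//]; congr pair.
  by apply/ffunP => -[].
- apply: ent_det => // s s'.
    move=> /(@messages_transcript K s s') tt'.
    by congr pair => //; apply/ffunP => i; rewrite !ffunE.
  by move=> /(congr1 snd)/(@transcript_messages K s s').
apply: ent_det => // s s' /[dup] /(congr1 fst) h /(congr1 snd) h'.
  by congr pair; [exact: yo h|exact: messages_transcript h'].
by congr pair; [exact: oy h|exact: transcript_messages h'].
Qed.

End CodeMessages.

Lemma source_markov (R : realType) (X1 X2 Y : finType) (p : X1 * X2 * Y -> R) :
  (forall x, 0 <= p x) ->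
  markov_chain p (@srcX1 X1 X2 Y) (@srcY X1 X2 Y) (@srcX2 X1 X2 Y) ->
  ent p (sel (true, false, true)) + ent p (sel (false, true, true)) =
  ent p (sel (true, true, true)) + ent p (sel (false, false, true)).
Proof.
move=> p_ge0 /(markov_chainP p_ge0); rewrite /cmi.
rewrite (@ent_det _ _ p _ _ [% _, _] (sel (true, false, true))); first last.
- by move=> s s' /selP[/= h _ h']; rewrite /srcX1 /srcY h// h'.
- by move=> s s' [h h']; apply/selP.
rewrite (@ent_det _ _ p _ _ [% @srcX2 X1 X2 Y, _] (sel (false, true, true))); first last.
- by move=> s s' /selP[/= _ h h']; rewrite /srcX2 /srcY h// h'.
- by move=> s s' [h h']; apply/selP.
rewrite (@ent_det _ _ p _ _ [% [% _, _], _] (sel (true, true, true))); first last.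
- by move=> s s' /selP[/= h h' h'']; rewrite /srcX1 /srcX2 /srcY h// h'// h''.
- by move=> s s' [h h' h'']; apply/selP.
rewrite (@ent_det _ _ p _ _ (@srcY X1 X2 Y) (sel (false, false, true))); first last.
- by move=> s s' /selP[/= _ _ h]; rewrite /srcY h.
- by move=> s s' h; apply/selP.
lra.
Qed.

Section CodeToAux.
Variables (R : realType) (X1 X2 Y : finType) (p : X1 * X2 * Y -> R).
Local Notation S := (X1 * X2 * Y)%type.
Hypothesis p_pmf : is_pmf p.
Hypothesis p_markov :
  markov_chain p (@srcX1 X1 X2 Y) (@srcY X1 X2 Y) (@srcX2 X1 X2 Y).
Variables (n : nat) (c : cdib_code X1 X2 n).
Hypothesis n_gt0 : (0 < n)%N.

Let p_ge0 := p_pmf.1.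
Let p1 := p_pmf.2.
Let Q := iid_pmf p (n := n).
Let Q_ge0 s : 0 <= Q s. Proof. exact: iid_ge0. Qed.
Let Q1 : \sum_s Q s = 1. Proof. exact: iid_sum1. Qed.
Let msg := code_msg c (Y := Y).
Let H q b j := ent Q [% obs (aux_mask q b), transcript msg j].
Let e b := ent p (sel b).

Let T := ({ffun 'I_n -> S} * 'I_n)%type.
Let P : T -> R := time_shared Q (n := n).
Let Src (t : T) : S := t.1 t.2.

(* [t.2] is the uniform time-sharing index. *)
Definition code_aux (j : nat) (t : T) :=
  (t.2, obs (aux_mask t.2 (false, false, false)) t.1, msg j t.1).

Let P_ge0 t : 0 <= P t. Proof. exact: time_shared_ge0. Qed.

Let n0 : (0 : R) < n%:R. Proof. by rewrite ltr0n. Qed.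

Let law_Src : law P Src =1 p.
Proof.
move=> x; rewrite /P (@law_time_shared_avg _ _ Q n _ (fun q s => s q)).
under eq_bigr do rewrite law_iid1//.
by rewrite sumr_const card_ord -[p x *+ n]mulr_natl mulKf// gt_eqF.
Qed.

Let avg (F : 'I_n -> R) := n%:R^-1 * \sum_q F q.

Let avgD F F' : avg (fun q => F q + F' q) = avg F + avg F'.
Proof. by rewrite /avg big_split mulrDr. Qed.
Let avgB F F' : avg (fun q => F q - F' q) = avg F - avg F'.
Proof. by rewrite /avg sumrB mulrBr. Qed.
Let avgC x : avg (fun=> x) = x.
Proof. by rewrite /avg sumr_const card_ord -[x *+ n]mulr_natl mulKf// gt_eqF. Qed.

Let avg3 x F F' :
  n%:R^-1 * (\sum_(q < n) (x + F q - F' q)) = x + avg F - avg F'.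
Proof. by rewrite -[LHS]/(avg _) avgB avgD avgC. Qed.
Let avg6 x F F' y L L' :
  n%:R^-1 * (\sum_(q < n) (x + F q - F' q - (y + L q - L' q))) =
  x + avg F - avg F' - (y + avg L - avg L').
Proof. by rewrite -!avg3 -mulrBr -sumrB. Qed.

Let Ha b j := avg (fun q => H q b j).

(** The successor matters: a nonempty transcript contains the time index, the empty one does not. *)
Let G b j : aux_ent P Src code_aux b j.+1 = log2 n%:R + Ha b j.+1.
Proof.
rewrite /Ha /avg.
rewrite -(@ent_time_shared _ _ Q n Q_ge0 Q1 n_gt0 _
  (fun q => [% obs (aux_mask q b), transcript msg j.+1])).
apply: ent_det => // -[s q] [s' q'].
  move=> /[dup] /(congr1 fst)/= ss /(congr1 snd)/= /[dup] /ffunP uu.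
  have := uu ord0; rewrite !ffunE /code_aux/= => -[qq oo _] _.
  rewrite -qq in oo *; congr (_, (_, _)); last first.
    apply/ffunP => i; have := uu i; rewrite !ffunE /code_aux/=.
    by move/(congr1 snd).
  apply/ffunP => i; move/ffunP: oo => /(_ i); rewrite !ffunE /aux_mask.
  case: (i =P q :> nat) => [/ord_inj ->|//] _.
  by move: ss; rewrite /Src/= -qq.
move=> /[dup] /(congr1 fst)/= qq /(congr1 snd)/=.
move=> /[dup] /(congr1 fst)/= + /(congr1 snd)/= tt'; rewrite -qq => /ffunP oo.
congr pair.
  by have := oo q; rewrite !ffunE /aux_mask eqxx.
apply/ffunP => i; rewrite !ffunE /code_aux/= ?qq; congr (_, _, _).
  apply/ffunP => k; have := oo k; rewrite ?qq !ffunE /aux_mask.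
  by case: eqP => // _ _; apply/selP; split.
by move/ffunP: tt' => /(_ i); rewrite !ffunE.
Qed.

Let G0 b : aux_ent P Src code_aux b 0 = e b.
Proof. exact: source_ent. Qed.

Lemma code_aux_sol k R1 R2 mu :
  n%:R^-1 * (\sum_(l < k.+1) log2 (code_nI c l)%:R) <= R1 ->
  n%:R^-1 * (\sum_(l < k.+1) log2 (code_nJ c l)%:R) <= R2 ->
  mu <= n%:R^-1 * mutual_info Q (blockwise (@srcY X1 X2 Y) (n := n))
          (fun s => messages c (blockwise (@srcX1 X1 X2 Y) s)
                               (blockwise (@srcX2 X1 X2 Y) s) k.+1) ->
  aux_sol p k.+1 R1 R2 mu P Src code_aux.
Proof.
(* The terms [L], to be log2 n, cancel. Entropies are abstracted to functions [h] and [g] so that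
   linear arithmetic treats them as atoms. *)
have key (h : coords -> nat -> R) (g : coords -> R) (N N' : nat) (i a b L : R) :
    g (true, true, false) - g (false, true, false)
      + h (false, true, false) N - h (true, true, false) N <= a ->
    g (false, true, true) - g (false, false, true)
      + h (false, false, true) N - h (false, true, true) N
      - (g (false, false, true) + h (false, false, false) N'
         - h (false, false, true) N') + i <= b ->
    g (true, true, true) - g (false, false, true)
      + h (false, false, true) N - h (true, true, true) N + i <= a + b ->
    i <= g (false, false, true) + h (false, false, false) N - h (false, false, true) N ->
    mu <= i -> a <= R1 -> b <= R2 ->
    [/\ g (true, true, false) - g (false, true, false)
        + (L + h (false, true, false) N) - (L + h (true, true, false) N) <= R1,
      g (false, true, true) - g (false, false, true)
        + (L + h (false, false, true) N) - (L + h (false, true, true) N)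
        - (g (false, false, true) + (L + h (false, false, false) N')
           - (L + h (false, false, true) N')) + mu <= R2,
      g (true, true, true) - g (false, false, true)
        + (L + h (false, false, true) N) - (L + h (true, true, true) N) + mu <= R1 + R2 &
      mu <= g (false, false, true) + (L + h (false, false, false) N)
        - (L + h (false, false, true) N)].
  by move=> *; split; lra.
rewrite code_mutual_info// -/msg => leR1 leR2 lemu.
have mk := source_markov p_ge0 p_markov.
have msz m j := @code_msg_size X1 X2 Y n c R Q m j Q_ge0 Q1.
have ev := @code_msg_even X1 X2 Y n c.
have od := @code_msg_odd X1 X2 Y n c.
have nV : 0 <= n%:R^-1 :> R by rewrite invr_ge0 ltW.
have scale (x y : R) : x <= y -> n%:R^-1 * x <= n%:R^-1 * y by exact: ler_wpM2l.
have sI : \sum_(l < k.+1) log2 (code_nI c l)%:R =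
    \sum_(l < k.+1) log2 (code_size c l.*2)%:R :> R.
  by apply: eq_bigr => l _; rewrite /code_size odd_double doubleK.
have sJ : \sum_(l < k.+1) log2 (code_nJ c l)%:R =
    \sum_(l < k.+1) log2 (code_size c l.*2.+1)%:R :> R.
  by apply: eq_bigr => l _; rewrite /code_size oddS odd_double/= uphalf_double.
have r1 := scale _ _ (rate1_le p_ge0 p1 ev od msz k.+1).
have r2 := scale _ _ (rate2_le p_ge0 p1 mk ev od msz k).
have r3 := scale _ _ (sum_rate_le p_ge0 p1 ev od msz k.+1).
have r4 := scale _ _ (relevance_le p_ge0 p1 msg k.+1.*2).
rewrite mulrDr in r2; rewrite mulrDr [X in _ <= X]mulrDr in r3.
rewrite -!sI -!sJ in r1 r2 r3.
rewrite avg3 in r1; rewrite avg6 in r2; rewrite avg3 in r3; rewrite avg3 in r4.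
have rates := key Ha e _ _ _ _ _ (log2 n%:R) r1 r2 r3 r4 lemu leR1 leR2.
clear key r1 r2 r3 r4 lemu leR1 leR2 sI sJ scale.
split=> //; first by split=> //; exact: time_shared_sum1.
  by rewrite !G0 doubleS !G.
move=> m mk2; clear rates.
have HE : Ha (step_mask m) m.+1 + Ha (true, true, true) m =
    Ha (true, true, true) m.+1 + Ha (step_mask m) m.
  rewrite -!avgD; congr (_ * _); apply: eq_bigr => q _.
  rewrite /step_mask; case: (boolP (odd m)) => om /=.
    exact: (aux_odd p_ge0 p1 mk ev od).
  exact: (aux_even p_ge0 p1 mk ev od).
(* At the first step the earlier transcript is empty and lacks the index and the side letters; by
   [aux0] these are independent of letter q, so the equation is unaffected. *)
clear mk msz ev od; case: m mk2 HE => [|m] _ HE.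
  have : Ha (true, true, true) 0 - Ha (step_mask 0) 0 = e (true, true, true) - e (step_mask 0).
    rewrite -avgB -[RHS]avgC; congr (_ * _); apply: eq_bigr => q _.
    exact: (aux0 p_ge0 p1).
  by rewrite !G0 !G; move: HE; move: Ha e => h g; lra.
by rewrite !G; move: HE; move: Ha => h; lra.
Qed.

End CodeToAux.

(** * Sparse reweighting *)

Section SparseWeights.
Variables (R : realFieldType) (V I : finType) (a : I -> V -> R).

Let weight_supp (r : V -> R) := [set v | r v != 0].

Lemma sparse_kernel (s : {set V}) : (#|I| < #|s|)%N ->
  exists d : V -> R, [/\ forall v, v \notin s -> d v = 0,
    exists v, d v != 0 & forall i, \sum_v d v * a i v = 0].
Proof.
move=> Is.
pose A := \matrix_(k < #|s|, i < #|I|) a (enum_val i) (enum_val k).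
have : kermx A != 0.
  rewrite kermx_eq0 /row_free; apply: contraL Is => /eqP <-.
  by rewrite -leqNgt rank_leq_col.
move=> /rowV0Pn[u /sub_kermxP uA u0].
pose d v := \sum_k u 0 k * (enum_val k == v)%:R.
have sum_d (F : V -> R) : \sum_v d v * F v = \sum_k u 0 k * F (enum_val k).
  transitivity (\sum_v \sum_k u 0 k * (enum_val k == v)%:R * F v).
    by apply: eq_bigr => v _; rewrite mulr_suml.
  rewrite exchange_big/=; apply: eq_bigr => k _.
  rewrite (bigD1 (enum_val k))//= eqxx mulr1 big1 ?addr0// => v.
  by rewrite eq_sym => /negbTE ->; rewrite mulr0 mul0r.
exists d; split.
- move=> v vs; apply: big1 => k _; have := enum_valP k.
  by case: eqP => [->|]; rewrite ?(negbTE vs)// mulr0.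
- have [k uk] : exists k, u 0 k != 0.
    apply/existsP; apply: contraR u0; rewrite negb_exists => /forallP u0.
    by apply/eqP/rowP => k; rewrite mxE; apply/eqP; have := u0 k; rewrite negbK.
  exists (enum_val k); rewrite /d (bigD1 k)//= eqxx mulr1 big1 ?addr0// => j jk.
  by rewrite (inj_eq enum_val_inj) (negbTE jk) mulr0.
move=> i; rewrite sum_d; have /matrixP/(_ 0 (enum_rank i)) := uA.
rewrite !mxE => {2}<-; apply: eq_bigr => k _.
by rewrite mxE enum_rankK.
Qed.

(* A basic solution of a linear programme with #|I| equality constraints has
   at most #|I| nonzero coordinates: move along a kernel direction that does
   not increase the objective until one more weight vanishes. *)
Lemma sparse_weights (g : V -> R) (y : I -> R) (r0 : V -> R) :
  (forall v, 0 <= r0 v) ->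
  (forall v, r0 v != 0 -> 0 < \sum_i y i * a i v) ->
  exists r, [/\ forall v, 0 <= r v, forall v, r0 v = 0 -> r v = 0,
    forall i, \sum_v r v * a i v = \sum_v r0 v * a i v,
    \sum_v r v * g v <= \sum_v r0 v * g v &
    (#|weight_supp r| <= #|I|)%N].
Proof.
have [N leN] := ubnP #|weight_supp r0|; elim: N => // N IHN in r0 leN *.
move=> r0_ge0 ypos.
have [le|lt] := leqP #|weight_supp r0| #|I|; first by exists r0; split.
have [d [d0 dn0 da]] : exists d : V -> R, [/\ forall v, r0 v = 0 -> d v = 0,
    exists v, d v != 0, forall i, \sum_v d v * a i v = 0 & \sum_v d v * g v <= 0].
  have [d [d0 [v dv] da]] := sparse_kernel lt.
  have d0' w : r0 w = 0 -> d w = 0 by move=> rw; rewrite d0// inE rw eqxx.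
  have [dg|dg] := leP (\sum_v d v * g v) 0; first by exists d; split=> //; exists v.
  exists (fun v => - d v); split=> [w /d0' ->| |i|]; first by rewrite oppr0.
  - by exists v; rewrite oppr_eq0.
  - by under eq_bigr do rewrite mulNr; rewrite sumrN da oppr0.
  - by under eq_bigr do rewrite mulNr; rewrite sumrN oppr_le0 ltW.
move=> dg.
(* The combination [y] of the constraints is positive on the support and vanishes along [d], so [d]
   cannot be nonnegative: the feasible set is bounded in this direction. *)
have [v0 dv0] : exists v, d v < 0.
  apply/existsP; apply: contraT; rewrite negb_exists => /forallP dge.
  have {}dge v : 0 <= d v by rewrite leNgt dge.
  have dw : \sum_v d v * (\sum_i y i * a i v) = 0.
    under eq_bigr do rewrite mulr_sumr.
    rewrite exchange_big/= big1// => i _.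
    by under eq_bigr do rewrite mulrCA; rewrite -mulr_sumr da mulr0.
  have dwge v : 0 <= d v * (\sum_i y i * a i v).
    have [/d0 ->|r0v] := eqVneq (r0 v) 0; first by rewrite mul0r.
    by rewrite mulr_ge0// ltW// ypos.
  case: dn0 => v dv; move/eqP: dw; rewrite psumr_eq0// => /allP/(_ v).
  rewrite mem_index_enum mulf_eq0 (negbTE dv)/= => /(_ isT).
  have r0v : r0 v != 0 by apply: contra dv => /eqP/d0 ->.
  by rewrite gt_eqF// ypos.
(* Ratio test of the simplex method: the largest step that keeps all weights nonnegative. *)
case: (@arg_minP _ _ _ v0 (fun v => d v < 0) (fun v => r0 v / - d v) dv0).
move=> v1 dv1 minv1.
pose t := r0 v1 / - d v1; pose r1 v := r0 v + t * d v.
have t_ge0 : 0 <= t by rewrite divr_ge0// oppr_ge0 ltW.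
have r1_ge0 v : 0 <= r1 v.
  have [dv|dv] := leP 0 (d v); first by rewrite addr_ge0// mulr_ge0.
  by have := minv1 v dv; rewrite -/t ler_pdivlMr ?oppr_gt0// mulrN /r1; lra.
have r1v1 : r1 v1 = 0.
  by rewrite /r1 /t invrN mulrN mulNr divfK ?lt_eqF// subrr.
have r10 v : r0 v = 0 -> r1 v = 0 by rewrite /r1 => /[dup] /d0 -> ->; rewrite mulr0 addr0.
have sum_r1 F : \sum_v r1 v * F v = \sum_v r0 v * F v + t * \sum_v d v * F v.
  by rewrite mulr_sumr -big_split/=; apply: eq_bigr => v _; rewrite /r1; ring.
have lt1 : (#|weight_supp r1| < N)%N.
  rewrite -ltnS; apply: leq_trans leN; rewrite ltnS; apply: proper_card; apply/properP; split.
    by apply/fintype.subsetP => v; rewrite !inE; apply: contra => /eqP/r10 ->.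
  exists v1; rewrite !inE ?r1v1 ?eqxx//.
  by apply: contraTneq dv1 => /d0 ->; rewrite ltxx.
have ypos1 v : r1 v != 0 -> 0 < \sum_i y i * a i v.
  by move=> r1v; apply: ypos; apply: contra r1v => /eqP/r10 ->.
have [r [r_ge0 r0r ra rg rs]] := IHN r1 lt1 r1_ge0 ypos1.
exists r; split=> // [v /r10/r0r//|i|].
  by rewrite ra sum_r1 da mulr0 addr0.
by rewrite (le_trans rg)// sum_r1 gerDl mulr_ge0_le0.
Qed.

End SparseWeights.

Definition rv_supp (R : realType) (T A_ : finType) (P : T -> R) (A : T -> A_) :
  {set A_} := [set a | law P A a != 0].

Section Reweight.
Variables (R : realType) (T B_ : finType) (P : T -> R) (V : T -> B_).
Hypothesis P_ge0 : forall t, 0 <= P t.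

Definition reweight (r : B_ -> R) (t : T) : R := r (V t) * P t.

(** The contribution of the event V = v to H(A) - H(A'). *)
Definition ent_gap (A_ A'_ : finType) (A : T -> A_) (A' : T -> A'_) (v : B_) : R :=
  - \sum_(t | V t == v) P t * (log2 (law P A (A t)) - log2 (law P A' (A' t))).

Variable r : B_ -> R.
Hypothesis r_ge0 : forall v, 0 <= r v.

Lemma reweight_ge0 t : 0 <= reweight r t.
Proof. exact: mulr_ge0. Qed.

Lemma law_reweight (A_ : finType) (A : T -> A_) (k : A_ -> B_) a :
  (forall t, k (A t) = V t) -> law (reweight r) A a = r (k a) * law P A a.
Proof.
by move=> kA; rewrite /law mulr_sumr; apply: eq_bigr => t /eqP <-; rewrite kA.
Qed.

(** When A and A' both determine V, each of their laws is multiplied by [r]; the logarithms of [r]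
    cancel in the difference, which is thus linear in [r]. *)
Lemma ent_reweight (A_ A'_ : finType) (A : T -> A_) (A' : T -> A'_)
    (k : A_ -> B_) (k' : A'_ -> B_) :
  (forall t, k (A t) = V t) -> (forall t, k' (A' t) = V t) ->
  ent (reweight r) A - ent (reweight r) A' = \sum_v r v * ent_gap A A' v.
Proof.
move=> kA kA'; transitivity (- \sum_t r (V t) *
    (P t * (log2 (law P A (A t)) - log2 (law P A' (A' t))))).
  rewrite !ent_sumT -opprD -sumrB; congr (- _); apply: eq_bigr => t _.
  rewrite (law_reweight _ kA) (law_reweight _ kA') kA kA' /reweight.
  have [->|rt] := eqVneq (r (V t)) 0; first by rewrite !mul0r subr0.
  have [->|Pt] := eqVneq (P t) 0; first by rewrite !(mulr0, mul0r) subr0.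
  have rp : 0 < r (V t) by rewrite lt_def rt r_ge0.
  by rewrite !log2M ?law_gt0//; ring.
rewrite (partition_big V xpredT)//= -sumrN; apply: eq_bigr => v _.
by rewrite /ent_gap mulrN mulr_sumr; congr (- _); apply: eq_bigr => t /eqP ->.
Qed.

End Reweight.

Section Reduce.
Variables (R : realType) (T B_ D_ Z_ J : finType) (P : T -> R).
Variables (V : T -> B_) (D : T -> D_) (Z : T -> Z_).
Variables (gs : J -> B_ -> R) (g : B_ -> R).
Hypothesis P_pmf : is_pmf P.
Hypothesis markovD : cmi P V Z D = 0.

Let P_ge0 := P_pmf.1.
(** The weight 1 cut down to the support of V, since [sparse_weights] wants a positive combination
    of the constraints wherever the initial weight is nonzero. *)
Let indic v : R := (law P V v != 0)%:R.

Lemma reweight_indic : reweight P V indic =1 P.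
Proof.
move=> t; rewrite /reweight /indic.
have [->|Pt] := eqVneq (P t) 0; first by rewrite mulr0.
by rewrite gt_eqF ?law_gt0// mul1r.
Qed.

Let law_V (P' : T -> R) d : \sum_v law P' [% V, D] (v, d) = law P' D d.
Proof. exact: law_pairl. Qed.

Let supp0 d : d \notin rv_supp P D -> law P D d = 0.
Proof. by rewrite inE negbK => /eqP. Qed.

Let D0 v d : law P D d = 0 -> law P [% V, D] (v, d) = 0.
Proof. exact: (@law_comp_eq0 _ _ _ P_ge0 _ _ [% V, D] snd (v, d)). Qed.

Let DZ0 (P' : T -> R) z d : (forall t, 0 <= P' t) -> law P' D d = 0 ->
  law P' [% Z, D] (z, d) = 0.
Proof. by move=> P'0; apply: (@law_comp_eq0 _ _ _ P'0 _ _ [% Z, D] snd (z, d)). Qed.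

(** One equation per point of the support of D keeps the law of D, hence the total mass, and by the
    Markov chain also the law of (Z, D). The sum of these equations has coefficients P(V = v), which
    is the positive combination required. *)
Lemma sparse_reweight : exists r : B_ -> R,
  let P' := reweight P V r in
  [/\ forall v, 0 <= r v,
    is_pmf P' /\ (#|rv_supp P' V| <= #|rv_supp P D| + #|J|)%N,
    law P' [% Z, D] =1 law P [% Z, D] /\ cmi P' V Z D = 0,
    forall j, \sum_v r v * gs j v = \sum_v indic v * gs j v &
    \sum_v r v * g v <= \sum_v indic v * g v].
Proof.
pose I := ('I_#|rv_supp P D| + J)%type.
pose a (i : I) v :=
  match i with inl k => law P [% V, D] (v, enum_val k) | inr j => gs j v end.
pose y (i : I) : R := if i is inl _ then 1 else 0.
have ysum v : \sum_i y i * a i v = law P V v.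
  rewrite big_sumType/= [X in _ + X]big1 ?addr0 => [|j _]; last by rewrite mul0r.
  under eq_bigr do rewrite mul1r.
  rewrite -(big_enum_val (fun d => law P [% V, D] (v, d))).
  rewrite -(law_pairl P D V v) big_mkcond/=; apply: eq_bigr => d _.
  have -> : law P [% D, V] (d, v) = law P [% V, D] (v, d).
    by apply: eq_bigl => t; rewrite !xpair_eqE andbC.
  by case: ifPn => // /supp0 /D0 ->.
have i_ge0 v : 0 <= indic v by rewrite ler0n.
have [|r [r_ge0 r0 ra rg rs]] := @sparse_weights R B_ I a g y indic i_ge0.
  by move=> v; rewrite ysum pnatr_eq0 eqb0 negbK => v0; rewrite lt_def v0 law_ge0.
exists r => P'.
have P'_ge0 : forall t, 0 <= P' t by apply: reweight_ge0.
have lawVD v d r' : law (reweight P V r') [% V, D] (v, d) = r' v * law P [% V, D] (v, d).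
  exact: (@law_reweight _ _ _ P V r' _ [% V, D] fst).
have lawD d : law P' D d = law P D d.
  rewrite -law_V; under eq_bigr do rewrite lawVD.
  have [dS|/supp0 d0] := boolP (d \in rv_supp P D); last first.
    by rewrite d0 big1// => v _; rewrite D0// mulr0.
  have := ra (inl (enum_rank_in dS d)); rewrite /a /= enum_rankK_in// => ->.
  have -> : law P D d = law (reweight P V indic) D d.
    by apply: eq_bigr => t _; rewrite reweight_indic.
  by rewrite -law_V; apply: eq_bigr => v _; rewrite lawVD.
have lawVZD v z d : law P' [% [% V, Z], D] (v, z, d) = r v * law P [% [% V, Z], D] (v, z, d).
  exact: (@law_reweight _ _ _ P V r _ [% [% V, Z], D] (fun x => x.1.1)).
have mk := (cmi_eq0P P_ge0 V Z D).1 markovD.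
have lawZD z d : law P' [% Z, D] (z, d) = law P [% Z, D] (z, d).
  have [d0|d0] := eqVneq (law P D d) 0; first by rewrite !DZ0// lawD.
  apply: (mulIf d0).
  have -> : law P' [% Z, D] (z, d) = \sum_v law P' [% [% V, Z], D] (v, z, d).
    rewrite -(law_pairl P' V [% Z, D] (z, d)); apply: eq_bigr => v _.
    by apply: eq_bigl => t; rewrite !xpair_eqE andbA.
  rewrite mulr_suml; under eq_bigr do rewrite lawVZD -mulrA mk mulrA -lawVD.
  by rewrite -mulr_suml law_V lawD mulrC.
split=> //.
- split.
    split=> //; rewrite -(sum_law1 _ D) (eq_bigr _ (fun d _ => lawD d)).
    by rewrite sum_law1 P_pmf.2.
  have := rs; rewrite card_sum card_ord; apply: leq_trans; apply/subset_leq_card/fintype.subsetP.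
  move=> v; rewrite !inE (@law_reweight _ _ _ P V r _ V id)// mulf_eq0 negb_or.
  by case/andP.
- split; first by move=> [z d].
  by apply/(cmi_eq0P P'_ge0) => v z d; rewrite lawVZD lawD -mulrA mk lawVD lawZD mulrA.
by move=> j; exact: (ra (inr j)).
Qed.

End Reduce.

(** * Cardinality bounds *)

Lemma pairI (A_ B_ : Type) (x y : A_ * B_) :
  x = y -> x.1 = y.1 /\ x.2 = y.2.
Proof. by move=> ->. Qed.

Lemma law_det (R : realType) (T C_ A_ : finType) (P P' : T -> R)
    (C : T -> C_) (A : T -> A_) :
  determines C A -> law P' C =1 law P C -> law P' A =1 law P A.
Proof.
move=> CA PP a; pose f c := omap A [pick t | C t == c].
have fE : Some \o A =1 f \o C.
  move=> t; rewrite /f /=; case: pickP => [t' /eqP/CA <-//|/(_ t)].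
  by rewrite eqxx.
have E Q : law Q A a = law (law Q C) f (Some a).
  by rewrite law_law -(eq_law Q fE).
by rewrite !E; apply: eq_bigr => c _.
Qed.

Lemma ent_eq_law (R : realType) (T A_ : finType) (P P' : T -> R) (A : T -> A_) :
  law P' A =1 law P A -> ent P' A = ent P A.
Proof. by move=> PP; congr (- _); apply: eq_bigr => a _; rewrite PP. Qed.

Lemma law_neq0P (R : realType) (T A_ : finType) (P : T -> R) (A : T -> A_) a :
  law P A a != 0 -> exists2 t, P t != 0 & A t = a.
Proof.
move=> La; have [t /andP[/eqP At Pt]|H] := pickP (fun t => (A t == a) && (P t != 0)).
  by exists t.
move/eqP: La; case; apply: big1 => t At; apply/eqP.
by have := H t; rewrite At/= => /negbFE.
Qed.

Lemma card_transcript_supp (R : realType) (T B_ : finType) (P : T -> R)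
    (U : nat -> T -> B_) m : (forall t, 0 <= P t) ->
  (#|rv_supp P (transcript U m)| <= \prod_(i < m) #|rv_supp P (U i)|)%N.
Proof.
move=> P_ge0; pose F (i : 'I_m) : pred B_ := fun b => b \in rv_supp P (U i).
apply: (@leq_trans #|family F|).
  apply/subset_leq_card/fintype.subsetP => w wS; apply/familyP => i; move: wS.
  rewrite !inE; apply: contra => /eqP li; apply/eqP.
  apply: (@law_comp_eq0 _ _ _ P_ge0 _ _ _ (fun w : {ffun 'I_m -> B_} => w i)).
  by rewrite -{}li; apply: eq_law => t /=; rewrite ffunE.
rewrite card_family foldrE big_map big_enum/=; apply: leq_prod => i _.
by apply: subset_leq_card; apply/fintype.subsetP.
Qed.

Section AuxReduction.
Variables (R : realType) (X1 X2 Y : finType) (p : X1 * X2 * Y -> R).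
Variables (K : nat) (R1 R2 mu : R) (T B_ : finType).
Variables (Src : T -> X1 * X2 * Y) (U : nat -> T -> B_).
Local Notation sol P := (aux_sol p K R1 R2 mu P Src U).
Local Notation G P := (aux_ent P Src U).
Local Notation D m := [% sel (step_mask m) \o Src, transcript U m].
Local Notation Z := (@sel X1 X2 Y (true, true, true) \o Src).

Lemma aux_cmi (P : T -> R) m : cmi P (U m) Z (D m) =
  G P (step_mask m) m.+1 + G P (true, true, true) m
  - G P (true, true, true) m.+1 - G P (step_mask m) m.
Proof.
rewrite /cmi; congr (_ + _ - _ - _); apply: ent_det => t t' /=.
- move=> /pairI/=[uu /pairI/=[ss tt']]; rewrite ss; congr pair.
  by apply: transcriptS; rewrite tt' uu.
- move=> /pairI/=[ss tt'].
  by rewrite ss (transcript_last tt') (transcript_le (leqnSn m) tt').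
- by move=> /pairI/=[zz /pairI/=[ss tt']]; rewrite zz tt'.
- move=> /pairI/=[zz tt'].
  have ss : sel (step_mask m) (Src t) = sel (step_mask m) (Src t').
    by apply: sel_submask zz.
  by rewrite zz ss tt'.
- move=> /pairI/=[/pairI/=[uu zz] /pairI/=[_ tt']]; rewrite zz; congr pair.
  by apply: transcriptS; rewrite tt' uu.
move=> /pairI/=[zz tt'].
have ss : sel (step_mask m) (Src t) = sel (step_mask m) (Src t').
  by apply: sel_submask zz.
by rewrite zz ss (transcript_last tt') (transcript_le (leqnSn m) tt').
Qed.

Lemma aux_submod (P : T -> R) b b' m : (forall t, 0 <= P t) -> submask b b' ->
  G P b' m.+1 - G P b' m <= G P b m.+1 - G P b m.
Proof.
move=> P_ge0 bb.
suff : G P b' m.+1 + G P b m <= G P b m.+1 + G P b' m by lra.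
apply: ent_submod => //.
- move=> t t' /= /pairI/=[ss tt']; rewrite ss; congr pair.
  exact: transcript_le (leqnSn m) _ _ tt'.
- by move=> t t' /= /pairI/=[ss tt']; rewrite tt'; congr pair; exact: sel_submask ss.
by move=> t t' /= /pairI/=[/pairI/=[_ tt'] /pairI/=[ss _]]; rewrite ss tt'.
Qed.

(** The conditional entropy of [U m] decreases as the mask grows from X2 to the whole letter; the
    Markov chain equates the two ends and so everything between. *)
Lemma aux_flat (P : T -> R) m b : odd m -> (forall t, 0 <= P t) ->
  cmi P (U m) Z (D m) = 0 -> submask (false, true, false) b ->
  G P b m.+1 - G P b m = G P (true, true, true) m.+1 - G P (true, true, true) m.
Proof.
move=> om P_ge0; rewrite aux_cmi /step_mask om/= => P0 cb.
have bT : submask b (true, true, true) by split.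
move: P0 (aux_submod m P_ge0 cb) (aux_submod m P_ge0 bT).
by move: (G P) => g; lra.
Qed.

Lemma card_step_supp (P : T -> R) m : (forall t, 0 <= P t) ->
  (#|rv_supp P (D m)| <=
   (if odd m then #|X2| else #|X1|) * #|rv_supp P (transcript U m)|)%N.
Proof.
move=> P_ge0.
have S2 z w : (z, w) \in rv_supp P (D m) -> w \in rv_supp P (transcript U m).
  rewrite !inE; apply: contra => /eqP w0; apply/eqP.
  exact: (@law_comp_eq0 _ _ _ P_ge0 _ _ _ snd (z, w)).
have S1 z w : (z, w) \in rv_supp P (D m) -> exists s, z = sel (step_mask m) s.
  by rewrite inE => /law_neq0P[t _ [<- _]]; exists (Src t).
case: ifP => om.
  pose f (x : X2 * {ffun 'I_m -> B_}) : (option X1 * option X2 * option Y) * _ :=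
    ((None, Some x.1, None), x.2).
  apply: (@leq_trans #|f @: finset.setX [set: X2] (rv_supp P (transcript U m))|).
    apply/subset_leq_card/fintype.subsetP => -[z w] zw; apply/imsetP.
    have [s zE] := S1 _ _ zw; exists (s.1.2, w); last by rewrite zE /step_mask om.
    by rewrite finset.in_setX inE (S2 _ _ zw).
  by rewrite (leq_trans (leq_imset_card _ _))// finset.cardsX cardsT.
pose f (x : X1 * {ffun 'I_m -> B_}) : (option X1 * option X2 * option Y) * _ :=
  ((Some x.1, None, None), x.2).
apply: (@leq_trans #|f @: finset.setX [set: X1] (rv_supp P (transcript U m))|).
  apply/subset_leq_card/fintype.subsetP => -[z w] zw; apply/imsetP.
  have [s zE] := S1 _ _ zw; exists (s.1.1, w); last by rewrite zE /step_mask om.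
  by rewrite finset.in_setX inE (S2 _ _ zw).
by rewrite (leq_trans (leq_imset_card _ _))// finset.cardsX cardsT.
Qed.

Section Step.
Variables (P : T -> R) (m : nat).
Hypothesis solP : sol P.
Hypothesis lt_m : (m < K.*2)%N.

Let P_pmf : is_pmf P. Proof. by case: solP. Qed.
Let P_ge0 := P_pmf.1.
Let mk j : (j < K.*2)%N -> cmi P (U j) Z (D j) = 0.
Proof.
by case: solP => _ _ _ H /H; rewrite aux_cmi; lra.
Qed.

Let gap b j b' j' := ent_gap P (U m) [% sel b \o Src, transcript U j]
  [% sel b' \o Src, transcript U j'].
Let indic v : R := (law P (U m) v != 0)%:R.

Let gapE r b j b' j' : (forall v, 0 <= r v) -> (m < j)%N -> (m < j')%N ->
  G (reweight P (U m) r) b j - G (reweight P (U m) r) b' j' =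
  \sum_v r v * gap b j b' j' v.
Proof.
move=> r_ge0 mj mj'.
pose k i (mi : (m < i)%N) (x : (option X1 * option X2 * option Y) *
  {ffun 'I_i -> B_}) := x.2 (Ordinal mi).
by apply: (@ent_reweight _ _ _ P (U m) P_ge0 r r_ge0 _ _ _ _ (k _ mj) (k _ mj')) => t;
  rewrite /k ffunE.
Qed.

Let gap_indic b j b' j' : (m < j)%N -> (m < j')%N ->
  G P b j - G P b' j' = \sum_v indic v * gap b j b' j' v.
Proof.
move=> mj mj'; rewrite -gapE//.
by congr (_ - _); apply: eq_ent => t; rewrite reweight_indic.
Qed.

Lemma reweight_sol_prefix r : let P' := reweight P (U m) r in
  (forall v, 0 <= r v) -> is_pmf P' ->
  law P' [% Z, D m] =1 law P [% Z, D m] -> cmi P' (U m) Z (D m) = 0 ->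
  [/\ law P' Src =1 p, forall b j, (j <= m)%N -> G P' b j = G P b j &
    forall j, (j < K.*2)%N ->
      G P' (step_mask j) j.+1 + G P' (true, true, true) j =
      G P' (true, true, true) j.+1 + G P' (step_mask j) j].
Proof.
move=> P' r_ge0 P'_pmf lawZD mk'.
have GE b j : (j <= m)%N -> G P' b j = G P b j.
  move=> jm; apply: ent_eq_law; apply: law_det lawZD => t t' /pairI/=[zz /pairI/=[_ tt']].
  congr pair; last exact: transcript_le jm _ _ tt'.
  by apply: sel_submask zz; split.
split=> //.
  move=> s; case: solP => _ <- _ _; apply: law_det lawZD s => t t' /pairI/=[[h1 h2 h3] _].
  by rewrite [Src t]surjective_pairing [(Src t).1]surjective_pairing h1 h2 h3 -!surjective_pairing.
move=> j jK; suff : cmi P' (U j) Z (D j) = 0 by rewrite aux_cmi; lra.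
have [jm|mj|->//] := ltngtP j m.
  by have := mk jK; rewrite !aux_cmi !GE// ltnW.
(* For j > m the conditioning contains [U m]: all four laws are multiplied by the same weight, and
   both sides of the product identity by its square. *)
apply/(cmi_eq0P P'_pmf.1) => a b c.
have := (cmi_eq0P P_ge0 _ _ _).1 (mk jK) a b c.
pose k (x : (option X1 * option X2 * option Y) * {ffun 'I_j -> B_}) := x.2 (Ordinal mj).
have kE t : k (D j t) = U m t by rewrite /k ffunE.
rewrite (law_reweight P r (A := [% [% U j, Z], D j]) (k := k \o snd))//.
rewrite (law_reweight P r (A := D j) (k := k))//.
rewrite (law_reweight P r (A := [% U j, D j]) (k := k \o snd))//.
rewrite (law_reweight P r (A := [% Z, D j]) (k := k \o snd))//=.
by move=> E; rewrite mulrACA E mulrACA.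
Qed.

(** The constant 4 counts the three rates and the relevance. The R2 bound involves two prefixes of
    the transcript, but their sum costs one equation; both must contain [U m], so step m may not be
    the last. Entropies with the empty prefix are fixed by the law of the source. *)
Lemma reduce_inner : (m.+1 < K.*2)%N -> exists r : B_ -> R,
  sol (reweight P (U m) r) /\
  (#|rv_supp (reweight P (U m) r) (U m)| <= #|rv_supp P (D m)| + 4)%N.
Proof.
move=> lt_m1; set M := K.*2.
have mM : (m < M.-1)%N by rewrite /M; lia.
pose gs (j : 'I_4) : B_ -> R := match val j with
  | 0 => gap (false, true, false) M (true, true, false) M
  | 1 => fun v => gap (false, false, true) M (false, true, true) M v
           + gap (false, false, true) M.-1 (false, false, false) M.-1 v
  | 2 => gap (false, false, true) M (true, true, true) M
  | _ => gap (false, false, false) M (false, false, true) M end.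
have [r [r_ge0 [P'_pmf le] [lawZD mk'] gsE _]] :=
  sparse_reweight gs (fun=> 0) P_pmf (mk lt_m).
rewrite card_ord in le; exists r; split=> //.
have [lawS GE mkv] := reweight_sol_prefix r_ge0 P'_pmf lawZD mk'.
have g0 := gsE (@Ordinal 4 0 isT); have g1 := gsE (@Ordinal 4 1 isT).
have g2 := gsE (@Ordinal 4 2 isT); have g3 := gsE (@Ordinal 4 3 isT).
rewrite /gs/= -gapE// -gap_indic// in g0.
rewrite /gs/= -gapE// -gap_indic// in g2.
rewrite /gs/= -gapE// -gap_indic// in g3.
have splitE (q : B_ -> R) F F' : \sum_v q v * (F v + F' v) =
    \sum_v q v * F v + \sum_v q v * F' v.
  by rewrite -big_split/=; apply: eq_bigr => v _; rewrite mulrDr.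
rewrite /gs/= !splitE -!(@gapE r)// -!gap_indic// in g1.
case: solP => _ _ hP _; split=> //; rewrite !(GE _ 0)//.
move: hP g0 g1 g2 g3; rewrite -/M.
move: (G P) (G (reweight P (U m) r)) => g g'; clearbody M.
by move=> [h1 h2 h3 h4] g0 g1 g2 g3; split; lra.
Qed.

(* At the last step the Markov chain makes the entropies of X1 given the rest
   independent of the weights, so that only H(X2 | Y, W) and H(Y | W) vary: the
   former is kept and the latter is minimised, saving constraints. *)
Lemma reduce_last : m.+1 = K.*2 -> exists r : B_ -> R,
  sol (reweight P (U m) r) /\
  (#|rv_supp (reweight P (U m) r) (U m)| <= #|rv_supp P (D m)| + 1)%N.
Proof.
move=> mK.
have om : odd m by have := odd_double K; rewrite -mK/= => /negbFE.
pose gs (_ : 'I_1) := gap (false, false, true) m.+1 (false, true, true) m.+1.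
pose g := gap (false, false, true) m.+1 (false, false, false) m.+1.
have [r [r_ge0 [P'_pmf le] [lawZD mk'] gsE gE]] :=
  sparse_reweight gs g P_pmf (mk lt_m).
rewrite card_ord in le; exists r; split=> //.
have [lawS GE mkv] := reweight_sol_prefix r_ge0 P'_pmf lawZD mk'.
have g0 := gsE ord0; rewrite /gs/= -gapE// -gap_indic// in g0.
rewrite /g/= -gapE// -gap_indic// in gE.
have fl b := @aux_flat P m b om P_ge0 (mk lt_m).
have fl' b := @aux_flat _ m b om P'_pmf.1 mk'.
have c1 : submask (false, true, false) (false, true, false) by split.
have c2 : submask (false, true, false) (true, true, false) by split.
have c3 : submask (false, true, false) (false, true, true) by split.
have GEm b := GE b m (leqnn m); have GE0 b := GE b 0 (leq0n m).
case: solP => _ _ hP _; split=> //; rewrite -mK/= in hP *.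
move: hP g0 gE (fl _ c1) (fl _ c2) (fl _ c3) (fl' _ c1) (fl' _ c2) (fl' _ c3) GEm GE0.
move: (G P) (G (reweight P (U m) r)) => h h'.
move=> [h1 h2 h3 h4] e0 e1 e2 e3 e4 e5 e6 e7 GEm GE0.
by rewrite !GEm in e5 e6 e7; rewrite !GEm !GE0; split; lra.
Qed.

End Step.

(** The bounds depend only on [X1], [X2] and [K], never on the code, which makes a common space
    possible. *)
Definition step_bound (m q : nat) : nat :=
  ((if odd m then #|X2| else #|X1|) * q + (if m.+1 == K.*2 then 1 else 4))%N.

Fixpoint hist_bound (m : nat) : nat :=
  if m is k.+1 then (hist_bound k * step_bound k (hist_bound k))%N else 1.

Definition aux_bound (m : nat) : nat := step_bound m (hist_bound m).

Lemma hist_boundE m : hist_bound m = (\prod_(i < m) aux_bound i)%N.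
Proof. by elim: m => [|m IHm]; rewrite ?big_ord0// big_ord_recr/= -IHm. Qed.

Lemma rv_supp_reweight (P : T -> R) m (r : B_ -> R) (A_ : finType) (A : T -> A_) :
  (forall t, 0 <= P t) -> rv_supp (reweight P (U m) r) A \subset rv_supp P A.
Proof.
move=> P_ge0; apply/fintype.subsetP => a; rewrite !inE => /law_neq0P[t].
rewrite /reweight mulf_eq0 negb_or => /andP[_ Pt] <-.
by rewrite gt_eqF// law_gt0.
Qed.

(** Increasing order works because the bound of a step uses the supports of earlier variables, and
    reweighting a later variable only shrinks supports. *)
Lemma aux_reduction (P : T -> R) : sol P -> exists P', sol P' /\
  forall i, (i < K.*2)%N -> (#|rv_supp P' (U i)| <= aux_bound i)%N.
Proof.
move=> solP; suff H m : (m <= K.*2)%N -> exists P', sol P' /\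
  forall i, (i < m)%N -> (#|rv_supp P' (U i)| <= aux_bound i)%N by exact: H.
elim: m => [_|m IHm lt_m]; first by exists P.
have [Q [solQ leQ]] := IHm (ltnW lt_m).
have Q_ge0 : forall t, 0 <= Q t by case: solQ => -[].
have DS : (#|rv_supp Q (D m)| <= (if odd m then #|X2| else #|X1|) * hist_bound m)%N.
  apply: leq_trans (card_step_supp m Q_ge0) _; rewrite leq_mul2l; apply/orP; right.
  apply: leq_trans (card_transcript_supp U m Q_ge0) _; rewrite hist_boundE.
  by apply: leq_prod => i _; exact: leQ.
have [r [solr ler]] : exists r, sol (reweight Q (U m) r) /\
   (#|rv_supp (reweight Q (U m) r) (U m)| <=
     #|rv_supp Q (D m)| + (if m.+1 == K.*2 then 1 else 4))%N.
  case: eqP => mK; first exact: reduce_last.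
  by apply: reduce_inner => //; lia.
exists (reweight Q (U m) r); split=> // i; rewrite ltnS leq_eqVlt => /predU1P[->|im].
  by apply: leq_trans ler _; rewrite leq_add2r.
by apply: leq_trans (leQ i im); apply/subset_leq_card/rv_supp_reweight.
Qed.

End AuxReduction.

(** * Compactness *)

Local Open Scope classical_set_scope.
Local Open Scope ring_scope.

Section Continuity.
Variable R : realType.

(* Near 0 the lower bound is the tangent line of [x ln x] at [c = e / 2]. *)
Lemma continuous_xlnx : continuous (fun x : R => x * ln x).
Proof.
move=> x; have [x0|x0|<-] := ltgtP 0 x.
- by apply: continuousM; [exact: cvg_id|exact: continuous_ln].
- rewrite /continuous_at (@ln0 _ x) ?mulr0 ?ltW//; apply: cvg_near_cst.
  near=> y; rewrite ln0 ?mulr0//; apply: ltW.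
  by near: y; exact: lt_nbhsl.
rewrite /continuous_at mul0r; apply/cvgrPdist_lt => e e0.
have [c c0 ec] : exists2 c : R, 0 < c & c + c = e.
  by exists (e / 2); rewrite ?divr_gt0// -splitr.
pose d := Num.min 1 (c / (`|ln c + 1| + 1)).
have d1 : 0 < `|ln c + 1| + 1 by rewrite ltr_wpDl.
have d0 : 0 < d by rewrite lt_min ltr01 divr_gt0.
have near_d : \forall y \near (0 : R), `|y| < d by exact: nbhs0_lt.
apply: filterS near_d => y yd.
rewrite sub0r normrN; have [y0|y0] := leP y 0; first by rewrite ln0// mulr0 normr0.
move: yd; rewrite gtr0_norm// lt_min => /andP[y1]; rewrite ltr_pdivlMr// => yc.
have up : y * ln y <= 0 by rewrite pmulr_rle0// ln_le0// ltW.
have lo : y * (ln c + 1) - c <= y * ln y.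
  have : ln (c / y) <= c / y - 1 by rewrite ln_le_sub1// divr_gt0.
  rewrite ln_div ?posrE// => h.
  have : y * (ln c - ln y) <= y * (c / y - 1) by rewrite ler_pM2l.
  by rewrite mulrBr mulrBr mulr1 mulrCA divff ?gt_eqF// mulr1; lra.
have : - (y * `|ln c + 1|) <= y * (ln c + 1).
  by rewrite -mulrN ler_pM2l// lerNl -normrN ler_norm.
move: yc; rewrite (ler0_norm up) mulrDr mulr1 -ec; lra.
Unshelve. all: by end_near.
Qed.

Lemma continuous_xlog2x : continuous (fun x : R => x * log2 x).
Proof.
rewrite (_ : (fun x => _) = (fun x => x * ln x) \* (fun=> (ln 2)^-1)).
  by move=> x; apply: continuousM; [exact: continuous_xlnx|exact: cst_continuous].
by apply/funext => x; rewrite /log2 mulrA.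
Qed.

Lemma continuous_sum (X : topologicalType) (I : finType) (Q : pred I) (f : I -> X -> R) :
  (forall i, continuous (f i)) -> continuous (fun x => \sum_(i | Q i) f i x).
Proof.
by move=> fc; apply: continuous_big => [|i _]; [exact: add_continuous|exact: fc].
Qed.

Lemma continuous_ent (X : topologicalType) (T A_ : finType) (P : X -> T -> R)
    (A : T -> A_) :
  (forall t, continuous (fun x => P x t)) -> continuous (fun x => ent (P x) A).
Proof.
move=> Pc x; apply: continuousN; apply: continuous_sum => a {}x.
apply: (@continuous_comp _ _ _ (fun x => law (P x) A a) (fun y : R => y * log2 y)).
  exact: continuous_sum.
exact: continuous_xlog2x.
Qed.

(** A cluster point of approximate solutions lies in every closed sublevel set, so one point serves
    all constraints at once. *)
Lemma compact_limit (X : topologicalType) (C : set X) (I : Type) (F : I -> X -> R) :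
  compact C -> (forall i, continuous (F i)) ->
  (forall eps, 0 < eps -> exists x, C x /\ forall i, F i x <= eps) ->
  exists x, C x /\ forall i, F i x <= 0.
Proof.
move=> cptC Fc H.
have /choice[u uP] : forall n : nat, exists x, C x /\ forall i, F i x <= n.+1%:R^-1.
  by move=> n; apply: H; rewrite invr_gt0 ltr0n.
have [|x [Cx clx]] := cptC (u @ \oo) _.
  by exists 0%N => // n _; exact: (uP n).1.
exists x; split=> // i; apply/ler_addgt0Pr => e e0; rewrite add0r.
have cl : closed [set y | F i y <= e].
  by apply: (@preimage_closed _ _ (F i) [set y | y <= e]) => [y _|]; [exact: Fc|exact: closed_le].
apply: cl; move: clx; rewrite clusterE; apply.
have [N _ leN] := near_infty_natSinv_lt (PosNum e0).
by exists N => //= n /leN /= /ltW; apply: le_trans; exact: (uP n).2.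
Qed.

End Continuity.

Section Limit.
Variables (R : realType) (X1 X2 Y : finType) (p : X1 * X2 * Y -> R).
Variables (K : nat) (R1 R2 mu : R) (T B_ : finType).
Variables (Src : T -> X1 * X2 * Y) (U : nat -> T -> B_).
Hypothesis p_pmf : is_pmf p.

Let vec := 'rV[R]_#|T|.
Let Pv (v : vec) t : R := v ord0 (enum_rank t).
Let G (v : vec) b j := aux_ent (Pv v) Src U b j.
Let M := K.*2.
Let sgn (b : bool) (x : R) := if b then x else - x.

Let lhs1 (g : coords -> nat -> R) :=
  g (true, true, false) 0 - g (false, true, false) 0
    + g (false, true, false) M - g (true, true, false) M.
Let lhs2 (g : coords -> nat -> R) :=
  g (false, true, true) 0 - g (false, false, true) 0
    + g (false, false, true) M - g (false, true, true) M
    - (g (false, false, true) 0 + g (false, false, false) M.-1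
       - g (false, false, true) M.-1).
Let lhs3 (g : coords -> nat -> R) :=
  g (true, true, true) 0 - g (false, false, true) 0
    + g (false, false, true) M - g (true, true, true) M.
Let lhs4 (g : coords -> nat -> R) :=
  g (false, false, true) 0 + g (false, false, false) M - g (false, false, true) M.
Let lhs5 m (g : coords -> nat -> R) :=
  g (step_mask m) m.+1 + g (true, true, true) m
    - (g (true, true, true) m.+1 + g (step_mask m) m).

(** Equations are coded as two opposite inequalities, told apart by the Boolean, so that
    [compact_limit] applies; indices beyond the last step give the trivial constraint 0. *)
Let constr (i : (X1 * X2 * Y) * bool + 'I_4 + nat * bool) (v : vec) : R :=
  match i with
  | inl (inl (s, b)) => sgn b (law (Pv v) Src s - p s)
  | inl (inr k) => match val k with
    | 0 => lhs1 (G v) - R1 | 1 => lhs2 (G v) + mu - R2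
    | 2 => lhs3 (G v) + mu - (R1 + R2) | _ => mu - lhs4 (G v) end
  | inr (m, b) => if (m < M)%N then sgn b (lhs5 m (G v)) else 0
  end.

Let contD (f g : vec -> R) : continuous f -> continuous g ->
  continuous (fun v => f v + g v).
Proof. by move=> fc gc v; apply: continuousD; [exact: fc|exact: gc]. Qed.

Let contN (f : vec -> R) : continuous f -> continuous (fun v => - f v).
Proof. by move=> fc v; apply: continuousN; exact: fc. Qed.

Let contPv t : continuous (Pv^~ t).
Proof. exact: coord_continuous. Qed.

Let contG b j : continuous (fun v => G v b j).
Proof. exact: continuous_ent. Qed.

Let cont_lhs (g : vec -> coords -> nat -> R) :
  (forall b j, continuous (fun v => g v b j)) ->
  [/\ continuous (fun v => lhs1 (g v)), continuous (fun v => lhs2 (g v)),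
    continuous (fun v => lhs3 (g v)), continuous (fun v => lhs4 (g v)) &
    forall m, continuous (fun v => lhs5 m (g v))].
Proof.
move=> gc; split=> [||||m]; rewrite /lhs1 /lhs2 /lhs3 /lhs4 /lhs5.
all: by repeat first [exact: gc|apply: contD|apply: contN].
Qed.

Let cont_constr i : continuous (constr i).
Proof.
have contC (x : R) : continuous (fun _ : vec => x) by exact: cst_continuous.
have [c1 c2 c3 c4 c5] := cont_lhs contG.
case: i => [[[s b]|[[|[|[|k]]] kP]]|[m b]] /=.
- have : continuous (fun v => law (Pv v) Src s - p s).
    by apply: contD => //; apply: continuous_sum.
  by case: b => //= h; apply: contN.
- exact: contD c1 (contC _).
- exact: contD (contD c2 (contC _)) (contC _).
- exact: contD (contD c3 (contC _)) (contC _).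
- exact: contD (contC _) (contN c4).
rewrite /constr; case: (m < M)%N; last exact: (contC 0).
by case: b; [exact: c5|apply: contN; exact: c5].
Qed.

(** A cube; total mass 1 comes from the constraints on the law of [Src]. *)
Let simplex : set vec := [set v | forall i, v ord0 i \in `[0, 1]].

Lemma aux_sol_limit :
  (forall eps, 0 < eps -> exists P : T -> R,
     aux_sol p K (R1 + eps) (R2 + eps) (mu - eps) P Src U) ->
  exists P : T -> R, aux_sol p K R1 R2 mu P Src U.
Proof.
move=> H.
have cpt : compact simplex.
  rewrite /simplex; apply: (@rV_compact R _ (fun=> `[(0 : R), 1]%classic)) => _.
  exact: segment_compact.
have [eps eps0|v [vS vc]] := compact_limit cpt cont_constr.
  (* The sum-rate inequality collects the tolerance three times, from R1, R2 and mu. *)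
  have [P [P_pmf lawP h14 h5]] := H (eps / 3) (divr_gt0 eps0 (ltr0n _ 3)).
  pose v : vec := \row_i P (enum_val i).
  have Pvv t : Pv v t = P t by rewrite /Pv mxE enum_rankK.
  have GE : G v = aux_ent P Src U.
    by apply/funext => b; apply/funext => j; exact: eq_ent.
  exists v; split.
    move=> i; rewrite /v mxE in_itv/= P_pmf.1 -P_pmf.2 (bigD1 (enum_val i))//= lerDl.
    by apply: sumr_ge0 => t _; exact: P_pmf.1.
  have e3 : 0 < eps / 3 by rewrite divr_gt0// ltr0n.
  have {}h5 m : (m < M)%N -> lhs5 m (G v) = 0.
    by rewrite GE => /h5 h5m; apply/eqP; rewrite subr_eq0; apply/eqP.
  have {h14} : [/\ lhs1 (G v) <= R1 + eps / 3,
      lhs2 (G v) + (mu - eps / 3) <= R2 + eps / 3,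
      lhs3 (G v) + (mu - eps / 3) <= R1 + eps / 3 + (R2 + eps / 3) &
      mu - eps / 3 <= lhs4 (G v)] by rewrite GE.
  move=> h14; case=> [[[s b]|k]|[m b]] /=.
  - have -> : law (Pv v) Src s = p s.
      by rewrite -lawP; apply: eq_bigr => t _; rewrite Pvv.
    by rewrite subrr /sgn oppr0 if_same ltW.
  - move: h14 h5; move: (G v) => g [h1 h2 h3 h4] _.
    by case: k => [[|[|[|k]]] kP] /=; lra.
  case: ifP => mM; last exact: ltW.
  rewrite h5//.
  by rewrite /sgn oppr0 if_same ltW.
have lawE : law (Pv v) Src =1 p.
  move=> s; have := vc (inl (inl (s, true))); have := vc (inl (inl (s, false))).
  by rewrite /=; lra.
exists (Pv v); split=> //.
- split=> [t|]; first by have := vS (enum_rank t); rewrite in_itv/= => /andP[].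
  by rewrite -(sum_law1 (Pv v) Src) (eq_bigr _ (fun s _ => lawE s)) p_pmf.2.
- have c1 := vc (inl (inr (@Ordinal 4 0 isT))).
  have c2 := vc (inl (inr (@Ordinal 4 1 isT))).
  have c3 := vc (inl (inr (@Ordinal 4 2 isT))).
  have c4 := vc (inl (inr (@Ordinal 4 3 isT))).
  have : [/\ lhs1 (G v) <= R1, lhs2 (G v) + mu <= R2,
      lhs3 (G v) + mu <= R1 + R2 & mu <= lhs4 (G v)] by rewrite /= in c1 c2 c3 c4; split; lra.
  by [].
move=> m mM; have := vc (inr (m, true)); have := vc (inr (m, false)).
rewrite /= mM => le1 le2; have : lhs5 m (G v) = 0 by lra.
by move/eqP; rewrite subr_eq0 => /eqP.
Qed.

End Limit.

(** * Back to the outer region *)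

Section Canonical.
Variables (R : realType) (X1 X2 Y : finType) (p : X1 * X2 * Y -> R) (K : nat).

Let bnd := aux_bound X1 X2 K.

(** The shape [.-1.+1] makes the ordinal type visibly inhabited, as [inord] requires; its size is
    still the bound, which is positive. *)
Definition canon_alphabet (l : nat) : finType := 'I_(bnd l).-1.+1.

Let N := (\sum_(i < K.*2) bnd i)%N.

Definition canon_space : finType :=
  (X1 * X2 * Y * {ffun 'I_(K.*2).+1 -> 'I_N.+1})%type.

Definition canon_src (t : canon_space) : X1 * X2 * Y := t.1.

Definition canon_var (l : nat) (t : canon_space) : canon_alphabet l :=
  inord (t.2 (inord l)).

(** The value of [canon_var] embedded in one alphabet for all steps, as the uniform family of
    [aux_sol] demands. *)
Definition canon_aux (l : nat) (t : canon_space) : 'I_N.+1 :=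
  inord (canon_var l t).

Lemma aux_bound_gt0 l : (0 < bnd l)%N.
Proof.
by rewrite /bnd /aux_bound /step_bound addn_gt0; apply/orP; right; case: (_ == _).
Qed.

Lemma aux_bound_le l : (l < K.*2)%N -> (bnd l <= N)%N.
Proof. by move=> lK; rewrite /N (bigD1 (Ordinal lK))//= leq_addr. Qed.

Lemma canon_aux_inj l t t' : (l < K.*2)%N ->
  canon_aux l t = canon_aux l t' -> canon_var l t = canon_var l t'.
Proof.
move=> lK /(congr1 (@nat_of_ord _)).
have lt u : (canon_var l u < N.+1)%N.
  apply: leq_trans (ltn_ord _) _; rewrite prednK ?aux_bound_gt0//.
  by apply: leq_trans (aux_bound_le lK) _.
rewrite /canon_aux (inordK (lt t)) (inordK (lt t')); exact: val_inj.
Qed.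

(** Each value is replaced by its rank in the support, which is injective there; by [ent_eqv] no
    entropy changes. *)
Lemma canonicalize (R1 R2 mu : R) (T B_ : finType) (P : T -> R)
    (Src : T -> X1 * X2 * Y) (U : nat -> T -> B_) :
  aux_sol p K R1 R2 mu P Src U ->
  (forall i, (i < K.*2)%N -> (#|rv_supp P (U i)| <= bnd i)%N) ->
  exists P' : canon_space -> R, aux_sol p K R1 R2 mu P' canon_src canon_aux.
Proof.
move=> [P_pmf lawS rates mk] le_supp.
pose code i v : nat := index v (enum (rv_supp P (U i))).
pose f t : canon_space := (Src t, [ffun i : 'I_(K.*2).+1 => inord (code i (U i t))]).
have codeE i t : (i < K.*2)%N -> P t != 0 ->
    canon_aux i (f t) = code i (U i t) :> nat /\ U i t \in enum (rv_supp P (U i)).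
  move=> iK Pt.
  have Us : U i t \in enum (rv_supp P (U i)).
    by rewrite mem_enum inE gt_eqF ?law_gt0//; exact: P_pmf.1.
  split=> //; have lt : (code i (U i t) < bnd i)%N.
    by apply: leq_trans (le_supp i iK); rewrite cardE index_mem.
  have b0 := aux_bound_gt0 i; have bN := aux_bound_le iK.
  have iE : (inord i : 'I_(K.*2).+1) = i :> nat by rewrite inordK// ltnW.
  have vE : canon_var i (f t) = code i (U i t) :> nat.
    by rewrite /canon_var /f /= ffunE iE !inordK//; lia.
  by rewrite /canon_aux inordK vE//; lia.
have GE b j : (j <= K.*2)%N ->
    aux_ent (law P f) canon_src canon_aux b j = aux_ent P Src U b j.
  move=> jK; rewrite /aux_ent -ent_law; apply: ent_eqv => t t' Pt Pt' /=.
  rewrite !xpair_eqE; congr (_ && _).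
  apply/eqP/eqP => /ffunP E; apply/ffunP => i; have := E i; rewrite !ffunE.
    have iK : (i < K.*2)%N by apply: leq_trans jK.
    have [c1 m1] := codeE i t iK Pt; have [c2 m2] := codeE i t' iK Pt'.
    move/(congr1 val); rewrite /= c1 c2 /code.
    by move=> /(congr1 (nth (U i t) (enum (rv_supp P (U i))))); rewrite !nth_index.
  have iK : (i < K.*2)%N by apply: leq_trans jK.
  have [c1 _] := codeE i t iK Pt; have [c2 _] := codeE i t' iK Pt'.
  by move=> uu; apply/val_inj; rewrite /= c1 c2 uu.
exists (law P f); split.
- by split=> [t|]; [apply: law_ge0; exact: P_pmf.1|rewrite sum_law1 P_pmf.2].
- by move=> s; rewrite law_law -lawS.
- by rewrite !GE//; lia.
by move=> m mK; have mK' := ltnW mK; rewrite !GE//; exact: mk.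
Qed.

End Canonical.

Section OuterRegion.
Variables (R : realType) (X1 X2 Y : finType) (p : X1 * X2 * Y -> R) (K : nat).
Variables (R1 R2 mu : R) (P : canon_space X1 X2 Y K -> R).
Hypothesis solP : aux_sol p K R1 R2 mu P (@canon_src X1 X2 Y K) (@canon_aux X1 X2 Y K).

Let Src := @canon_src X1 X2 Y K.
Let U := @canon_aux X1 X2 Y K.
Let V1 l := @canon_var X1 X2 Y K l.*2.
Let V2 l := @canon_var X1 X2 Y K l.*2.+1.
Let W1 := W1rv V1 V2.
Let W2 := W2rv V1 V2.

Let P_ge0 t : 0 <= P t. Proof. by case: solP => -[]. Qed.

Let var_aux l t t' : canon_var l t = canon_var l t' -> U l t = U l t'.
Proof. by rewrite /U /canon_aux => ->. Qed.

Let transcript_W1 l t t' : (l <= K)%N ->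
  transcript U l.*2 t = transcript U l.*2 t' -> W1 l t = W1 l t'.
Proof.
elim: l => // l IHl lK; rewrite doubleS => tt.
have t1 := transcript_le (leqnSn _) tt.
rewrite /W1 /W1rv /=; congr (_, (_, _)).
- by apply: IHl; [exact: ltnW|exact: transcript_le (leqnSn _) _ _ t1].
- by apply: canon_aux_inj (transcript_last t1); lia.
by apply: canon_aux_inj (transcript_last tt); lia.
Qed.

Let W1_transcript l t t' : W1 l t = W1 l t' ->
  transcript U l.*2 t = transcript U l.*2 t'.
Proof.
elim: l => [_|l IHl]; first by apply/ffunP => -[].
rewrite /W1 /W1rv /= => /pairI/=[/IHl tt /pairI/=[v1 v2]].
rewrite doubleS; apply: transcriptS; congr pair; last exact: var_aux.
by apply: transcriptS; congr pair => //; exact: var_aux.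
Qed.

Let transcript_W2 l t t' : (l < K)%N ->
  transcript U l.*2.+1 t = transcript U l.*2.+1 t' -> W2 l t = W2 l t'.
Proof.
move=> lK tt; rewrite /W2 /W2rv; congr pair.
  by apply: transcript_W1; [exact: ltnW|exact: transcript_le (leqnSn _) _ _ tt].
by apply: canon_aux_inj (transcript_last tt); lia.
Qed.

Let W2_transcript l t t' : W2 l t = W2 l t' ->
  transcript U l.*2.+1 t = transcript U l.*2.+1 t'.
Proof.
move=> /pairI/=[/W1_transcript tt v1].
by apply: transcriptS; congr pair => //; exact: var_aux.
Qed.

Let G := aux_ent P Src U.

Let x1 t := srcX1 (Src t).
Let x2 t := srcX2 (Src t).
Let y t := srcY (Src t).

Let ent_aux (A_ : finType) (A : _ -> A_) (b : coords) j :
  (forall t t', A t = A t' -> [/\ b.1.1 -> x1 t = x1 t', b.1.2 -> x2 t = x2 t',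
     b.2 -> y t = y t' & transcript U j t = transcript U j t']) ->
  (forall t t', (b.1.1 -> x1 t = x1 t') -> (b.1.2 -> x2 t = x2 t') ->
     (b.2 -> y t = y t') -> transcript U j t = transcript U j t' -> A t = A t') ->
  ent P A = G b j.
Proof.
move=> h1 h2; apply: ent_det => t t'.
  by move=> /h1[? ? ? ->] /=; congr pair; apply/selP; split.
by move=> /pairI/=[/selP[? ? ?] ?]; exact: h2.
Qed.

Let tr0 t t' : transcript U 0 t = transcript U 0 t'.
Proof. by apply/ffunP => -[]. Qed.

Ltac unpack := repeat match goal with
  | H : (_, _) = (_, _) |- _ => case/pairI: H => /= ? ? end.

Let ent_src (b : coords) (A_ : finType) (A : _ -> A_) :
  (forall t t', A t = A t' -> [/\ b.1.1 -> x1 t = x1 t', b.1.2 -> x2 t = x2 t' &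
     b.2 -> y t = y t']) ->
  (forall t t', (b.1.1 -> x1 t = x1 t') -> (b.1.2 -> x2 t = x2 t') ->
     (b.2 -> y t = y t') -> A t = A t') ->
  ent P A = G b 0.
Proof.
move=> h1 h2; apply: ent_aux => t t'; last by move=> a1 a2 a3 _; exact: h2.
by move=> /h1[a1 a2 a3]; split=> //; exact: tr0.
Qed.

Ltac src_tac :=
  let h1 := fresh "h" in let h2 := fresh "h" in let h3 := fresh "h" in
  apply: ent_src => t t' /=;
  first [by move=> ?; unpack; split=> // | by move=> h1 h2 h3;
    rewrite ?(h1 isT) ?(h2 isT) ?(h3 isT)].

Let ent_W1 (b : coords) l (A_ : finType) (A : _ -> A_) : (l <= K)%N ->
  (forall t t', A t = A t' -> [/\ b.1.1 -> x1 t = x1 t', b.1.2 -> x2 t = x2 t',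
     b.2 -> y t = y t' & W1 l t = W1 l t']) ->
  (forall t t', (b.1.1 -> x1 t = x1 t') -> (b.1.2 -> x2 t = x2 t') ->
     (b.2 -> y t = y t') -> W1 l t = W1 l t' -> A t = A t') ->
  ent P A = G b l.*2.
Proof.
move=> lK h1 h2; apply: ent_aux => t t'.
  by move=> /h1[a1 a2 a3 a4]; split=> //; exact: W1_transcript.
by move=> a1 a2 a3 tt; apply: h2 => //; exact: transcript_W1.
Qed.

Let ent_W2 (b : coords) l (A_ : finType) (A : _ -> A_) : (l < K)%N ->
  (forall t t', A t = A t' -> [/\ b.1.1 -> x1 t = x1 t', b.1.2 -> x2 t = x2 t',
     b.2 -> y t = y t' & W2 l t = W2 l t']) ->
  (forall t t', (b.1.1 -> x1 t = x1 t') -> (b.1.2 -> x2 t = x2 t') ->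
     (b.2 -> y t = y t') -> W2 l t = W2 l t' -> A t = A t') ->
  ent P A = G b l.*2.+1.
Proof.
move=> lK h1 h2; apply: ent_aux => t t'.
  by move=> /h1[a1 a2 a3 a4]; split=> //; exact: W2_transcript.
by move=> a1 a2 a3 tt; apply: h2 => //; exact: transcript_W2.
Qed.

Ltac W_tac lem :=
  let h1 := fresh "h" in let h2 := fresh "h" in let h3 := fresh "h" in
  let h4 := fresh "h" in apply: lem => // t t' /=;
  first [by move=> ?; unpack; split=> // | by move=> h1 h2 h3 h4;
    rewrite ?(h1 isT) ?(h2 isT) ?(h3 isT) ?h4].

Let rate1E : cmi P x1 (W1 K) x2 =
  G (true, true, false) 0 + G (false, true, false) K.*2
  - G (true, true, false) K.*2 - G (false, true, false) 0.
Proof.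
rewrite /cmi; congr (_ + _ - _ - _).
- by src_tac.
- by W_tac ent_W1.
- by W_tac ent_W1.
- by src_tac.
Qed.

Let rate2E : cmi P x2 (W1 K) y =
  G (false, true, true) 0 + G (false, false, true) K.*2
  - G (false, true, true) K.*2 - G (false, false, true) 0.
Proof.
rewrite /cmi; congr (_ + _ - _ - _).
- by src_tac.
- by W_tac ent_W1.
- by W_tac ent_W1.
- by src_tac.
Qed.

Let sum_rateE : cmi P [% x1, x2] (W1 K) y =
  G (true, true, true) 0 + G (false, false, true) K.*2
  - G (true, true, true) K.*2 - G (false, false, true) 0.
Proof.
rewrite /cmi; congr (_ + _ - _ - _).
- by src_tac.
- by W_tac ent_W1.
- by W_tac ent_W1.
- by src_tac.
Qed.

Let relevanceE : mi P y (W1 K) =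
  G (false, false, true) 0 + G (false, false, false) K.*2
  - G (false, false, true) K.*2.
Proof.
rewrite /mi; congr (_ + _ - _).
- by src_tac.
- by W_tac ent_W1.
- by W_tac ent_W1.
Qed.

Let relevance2E l : (l < K)%N -> mi P y (W2 l) =
  G (false, false, true) 0 + G (false, false, false) l.*2.+1
  - G (false, false, true) l.*2.+1.
Proof.
move=> lK; rewrite /mi; congr (_ + _ - _).
- by src_tac.
- by W_tac ent_W2.
- by W_tac ent_W2.
Qed.

Let W2E l t t' : V1 l t = V1 l t' -> W1 l t = W1 l t' -> W2 l t = W2 l t'.
Proof. by move=> v w; rewrite /W2 /W2rv; congr pair. Qed.

Let W1SE l t t' : V2 l t = V2 l t' -> W2 l t = W2 l t' -> W1 l.+1 t = W1 l.+1 t'.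
Proof.
move=> v /pairI/=[w1 w2]; rewrite /W1 /W1rv/=; congr (_, (_, _)) => //; exact: w1.
Qed.

Let markov1E l : (l < K)%N -> cmi P (V1 l) [% x2, y] [% x1, W1 l] =
  G (true, false, false) l.*2.+1 + G (true, true, true) l.*2
  - G (true, true, true) l.*2.+1 - G (true, false, false) l.*2.
Proof.
move=> lK; have lK' := ltnW lK; rewrite /cmi; congr (_ + _ - _ - _).
- apply: ent_W2 => // t t' /=; first by move=> ?; unpack; split=> //; exact: W2E.
  move=> h1 _ _ /pairI/=[w v]; have {}w : W1 l t = W1 l t' by exact: w.
  by rewrite (h1 isT) v w.
- by W_tac ent_W1.
- apply: ent_W2 => // t t' /=; first by move=> ?; unpack; split=> //; exact: W2E.
  move=> h1 h2 h3 /pairI/=[w v]; have {}w : W1 l t = W1 l t' by exact: w.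
  by rewrite (h1 isT) (h2 isT) (h3 isT) v w.
- by W_tac ent_W1.
Qed.

Let markov2E l : (l < K)%N -> cmi P (V2 l) [% x1, y] [% x2, W2 l] =
  G (false, true, false) l.*2.+2 + G (true, true, true) l.*2.+1
  - G (true, true, true) l.*2.+2 - G (false, true, false) l.*2.+1.
Proof.
move=> lK; rewrite /cmi -doubleS; congr (_ + _ - _ - _).
- apply: ent_W1 => // t t' /=; first by move=> ?; unpack; split=> //; exact: W1SE.
  by move=> _ h2 _ /pairI/=[w /pairI/=[v1 v2]]; rewrite (h2 isT) v2 (W2E v1 w).
- by W_tac ent_W2.
- apply: ent_W1 => // t t' /=; first by move=> ?; unpack; split=> //; exact: W1SE.
  move=> h1 h2 h3 /pairI/=[w /pairI/=[v1 v2]].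
  by rewrite (h1 isT) (h2 isT) (h3 isT) v2 (W2E v1 w).
- by W_tac ent_W2.
Qed.

Let A1 l := canon_alphabet X1 X2 K l.*2.
Let A2 l := canon_alphabet X1 X2 K l.*2.+1.

Let card_A l : #|canon_alphabet X1 X2 K l| = aux_bound X1 X2 K l.
Proof. by rewrite card_ord prednK// aux_bound_gt0. Qed.

Let cardW1E l : cardW1 A1 A2 l = hist_bound X1 X2 K l.*2.
Proof.
rewrite /cardW1; elim: l => [|l IHl]; first by rewrite big_ord0.
by rewrite big_ord_recr/= IHl !card_A mulnA.
Qed.

Let cardW2E l : cardW2 A1 A2 l = hist_bound X1 X2 K l.*2.+1.
Proof. by rewrite /cardW2 cardW1E card_A. Qed.

Lemma aux_sol_outer : (0 < K)%N -> 0 <= R1 -> 0 <= R2 -> 0 <= mu ->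
  in_outer_region p K R1 R2 mu.
Proof.
move=> K0 R1_0 R2_0 mu0; split; first by split.
case: solP => P_pmf lawS rates mk.
have K1 : (K.-1 < K)%N by rewrite prednK.
have K1E : K.-1.*2.+1 = K.*2.-1 by rewrite -{2}(prednK K0).
exists (canon_space X1 X2 Y K), P, x1, x2, y, A1, A2, V1, V2; split.
- split=> // s; rewrite -lawS; exact: eq_law.
- rewrite -/W1 -/W2 !cond_mutual_infoE// !mutual_infoE//.
  rewrite rate1E rate2E sum_rateE relevanceE (relevance2E K1) K1E.
  move: rates; rewrite -[aux_ent _ _ _]/G; move: G => g [h1 h2 h3 h4].
  by split; rewrite ?ge_max ?R2_0 ?andbT; lra.
- move=> l lK; clear rates; split.
    apply/markov_chainP => //; rewrite -/W1 markov1E//.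
    have : G (true, false, false) l.*2.+1 + G (true, true, true) l.*2 =
        G (true, true, true) l.*2.+1 + G (true, false, false) l.*2.
      by have := mk l.*2; rewrite /step_mask odd_double; apply; rewrite ltn_double.
    by clear mk; move: G => g; lra.
  apply/markov_chainP => //; rewrite -/W2 markov2E//.
  have : G (false, true, false) l.*2.+2 + G (true, true, true) l.*2.+1 =
      G (true, true, true) l.*2.+2 + G (false, true, false) l.*2.+1.
    have := mk l.*2.+1; rewrite /step_mask oddS odd_double; apply.
    by rewrite -doubleS leq_double.
  by clear mk; move: G => g; lra.
split=> [l lK|l lK|].
- rewrite cardW1E card_A /aux_bound /step_bound odd_double.
  (* By parity an even step is never the last, so its slack is 4. *)
  by case: eqP => // E; have := odd_double K; rewrite -E /= odd_double.
- rewrite cardW2E card_A /aux_bound /step_bound oddS odd_double/=.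
  by case: eqP => // E; lia.
rewrite cardW2E card_A /aux_bound /step_bound oddS odd_double/=.
by case: eqP => // -[]; lia.
Qed.

End OuterRegion.

Theorem theorem3 (R : realType) (X1 X2 Y : finType) (p : X1 * X2 * Y -> R)
  (K : nat) (p_pmf : is_pmf p)
  (p_markov : markov_chain p (@srcX1 X1 X2 Y) (@srcY X1 X2 Y) (@srcX2 X1 X2 Y))
  (K_ge1 : (1 <= K)%N) :
  cdib_region p K `<=` outer_region p K.
Proof.
move=> [[R1 R2] mu] /= [[R1_0 R2_0 mu0] H].
suff [P solP] : exists P,
    aux_sol p K R1 R2 mu P (@canon_src X1 X2 Y K) (@canon_aux X1 X2 Y K).
  exact: aux_sol_outer solP K_ge1 R1_0 R2_0 mu0.
apply: (aux_sol_limit p_pmf) => eps eps0.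
(* One block length per tolerance is enough. *)
have [n0 /(_ n0.+1 (ltnSn _))[c [r1 r2 r3]]] := H eps eps0.
case: K K_ge1 r1 r2 r3 {H} => // k _ r1 r2 r3.
have sol := code_aux_sol p_pmf p_markov (ltn0Sn n0) r1 r2 r3.
have [P [solP leP]] := aux_reduction sol.
exact: canonicalize solP leP.
Qed.
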